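(* Let $q$ be a prime power, $n\ge0$, and let $\mathbf L(n,q)$ be the Hasse graph of the lattice of subspaces of $\mathbf F_q^n$. Then $$\frac{1-t}{H(A(\mathbf L(n,q)),t)}=1-t\sum_{m=0}^n\binom nm_q(1-t)(1-tq)\cdots(1-tq^{n-m-1}),$$ where $\binom nm_q$ is the $q$-binomial coefficient (number of $m$-dimensional subspaces of $\mathbf F_q^n$) and the product $(1-t)(1-tq)\cdots(1-tq^{n-m-1})$ is $1$ when $m=n$.
   Context: $\mathbf L(n,q)$ is the layered directed graph whose vertices are the subspaces of $\mathbf F_q^n$, the level of a subspace being its dimension, with exactly one edge from $U$ to $W$ whenever $W\subset U$ and $\dim W=\dim U-1$ (tail $U$, head $W$); its unique vertex of level $0$ is $(0)$. For a layered directed graph $\Gamma=(V,E)$ (maps $\mathbf t,\mathbf h:E\to V$, edges go from level $i$ to level $i-1$), a path $\pi=(e_1,\dots,e_m)$ is a sequence of edges with $\mathbf t(e_{i+1})=\mathbf h(e_i)$. Fix a field $F$, let $T(E)$ be the free associative $F$-algebra on $E$, put $P_\pi(\tau)=(\tau-e_1)\cdots(\tau-e_m)=\sum_{j=0}^m e(\pi,j)\tau^{m-j}$ ($\tau$ central), and let $R$ be the ideal generated by all $e(\pi_1,k)-e(\pi_2,k)$ for paths $\pi_1,\pi_2$ with common tail and common head and $1\le k\le$ length of $\pi_1$. $A(\Gamma)=T(E)/R$, graded with edges in degree $1$, and $H(A,t)=\sum_i\dim A_i\,t^i$. *)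

(* Defs.v *)
From HB Require Import structures.
From mathcomp Require Import all_boot all_order all_algebra.
From mathcomp Require Import generic_quotient ring_quotient.
From mathcomp.classical Require Import boolp.
From mathcomp.multinomials Require Import monalg.

Set Implicit Arguments.
Unset Strict Implicit.
Unset Printing Implicit Defensive.
Import GRing.Theory.
Local Open Scope ring_scope.
Local Open Scope quotient_scope.

Record layered_graph := LayeredGraph {
  vertex : choiceType;
  edge : choiceType;
  tail : edge -> vertex;
  head : edge -> vertex;
  level : vertex -> nat;
  level_edge : forall e, level (tail e) = (level (head e)).+1
}.

Section TwoSidedQuotient.
Variables (F : fieldType) (T : lalgType F) (S : T -> Prop).

Definition two_sided_ideal (I : T -> Prop) : Prop :=
  [/\ I 0,
      forall x y, I x -> I y -> I (x - y)
    & forall a x, I x -> I (a * x) /\ I (x * a)].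

Definition ideal_generated (x : T) : Prop :=
  forall I : T -> Prop,
    two_sided_ideal I -> (forall s, S s -> I s) -> I x.

Lemma ideal_generatedP : two_sided_ideal ideal_generated.
Proof.
split=> [I [] //|x y Ix Iy I idI sI|a x Ix].
  by case: (idI) => _ + _; apply; [apply: Ix|apply: Iy].
by split=> I idI sI; case: (idI) => _ _ /(_ a x (Ix I idI sI)) [].
Qed.

(* Classical membership test, as the quotient construction wants a bool. *)
Definition ideal_pred : {pred T} := fun x => `[< ideal_generated x >].

Lemma ideal_predP x : reflect (ideal_generated x) (x \in ideal_pred).
Proof. exact: asboolP. Qed.

Lemma ideal_pred_zmod : zmod_closed ideal_pred.
Proof.
case: ideal_generatedP => I0 IB _.
by split=> [|x y /ideal_predP Ix /ideal_predP Iy]; apply/ideal_predP; auto.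
Qed.

HB.instance Definition _ := GRing.isZmodClosed.Build T ideal_pred ideal_pred_zmod.

Lemma ideal_predMl a x : x \in ideal_pred -> a * x \in ideal_pred.
Proof.
by move/ideal_predP=> Ix; apply/ideal_predP;
   case: ideal_generatedP => _ _ /(_ a x Ix) [].
Qed.

Lemma ideal_predMr a x : x \in ideal_pred -> x * a \in ideal_pred.
Proof.
by move/ideal_predP=> Ix; apply/ideal_predP;
   case: ideal_generatedP => _ _ /(_ a x Ix) [].
Qed.

(* The library only makes Quotient.quot a ring for T commutative; here it gets
   a ring and an F-module structure (compatible, by aq_scaleAl) for T arbitrary.
   It is a pzRing because it may be zero. *)
Definition alg_quot := Quotient.quot ideal_pred.
HB.instance Definition _ := GRing.Zmodule.on alg_quot.
HB.instance Definition _ := Quotient.on alg_quot.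

Definition aq_one : alg_quot := \pi_alg_quot 1.
Definition aq_mul (x y : alg_quot) : alg_quot := \pi_alg_quot (repr x * repr y).
Definition aq_scale (c : F) (x : alg_quot) : alg_quot := \pi_alg_quot (c *: repr x).

Lemma aq_eqP (x y : T) :
  reflect (\pi_alg_quot x = \pi_alg_quot y) (x - y \in ideal_pred).
Proof.
have E : (\pi_alg_quot x == \pi_alg_quot y) = (x - y \in ideal_pred).
  exact: (@eqquotE _ _ (Quotient.quot ideal_pred) x y).
by rewrite -E; exact: eqP.
Qed.

Lemma aq_repr (x : T) : x - repr (\pi_alg_quot x) \in ideal_pred.
Proof. by apply/aq_eqP; rewrite reprK. Qed.

Lemma pi_aqD x y : \pi_alg_quot (x + y) = \pi_alg_quot x + \pi_alg_quot y.
Proof. exact: (@Quotient.pi_add T ideal_pred x y). Qed.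

Lemma pi_aqM x y : \pi_alg_quot (x * y) = aq_mul (\pi_alg_quot x) (\pi_alg_quot y).
Proof.
apply/aq_eqP; set x' := repr _; set y' := repr _.
have -> : x * y - x' * y' = x * (y - y') + (x - x') * y'.
  by rewrite mulrBr mulrBl addrA subrK.
by apply: rpredD; [apply: ideal_predMl|apply: ideal_predMr]; exact: aq_repr.
Qed.

Lemma pi_aqZ c x : \pi_alg_quot (c *: x) = aq_scale c (\pi_alg_quot x).
Proof.
by apply/aq_eqP; rewrite -scalerBr -mulr_algl; apply: ideal_predMl; exact: aq_repr.
Qed.

Lemma aq_ind (P : alg_quot -> Prop) : (forall x, P (\pi_alg_quot x)) -> forall x, P x.
Proof. by move=> Ppi x; rewrite -(reprK x). Qed.

Lemma aq_mulA : associative aq_mul.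
Proof.
by elim/aq_ind=> x; elim/aq_ind=> y; elim/aq_ind=> z; rewrite -!pi_aqM mulrA.
Qed.
Lemma aq_mul1r : left_id aq_one aq_mul.
Proof. by elim/aq_ind=> x; rewrite -pi_aqM mul1r. Qed.
Lemma aq_mulr1 : right_id aq_one aq_mul.
Proof. by elim/aq_ind=> x; rewrite -pi_aqM mulr1. Qed.
Lemma aq_mulDl : left_distributive aq_mul +%R.
Proof.
by elim/aq_ind=> x; elim/aq_ind=> y; elim/aq_ind=> z;
   rewrite -pi_aqD -!pi_aqM -pi_aqD mulrDl.
Qed.
Lemma aq_mulDr : right_distributive aq_mul +%R.
Proof.
by elim/aq_ind=> x; elim/aq_ind=> y; elim/aq_ind=> z;
   rewrite -pi_aqD -!pi_aqM -pi_aqD mulrDr.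
Qed.

HB.instance Definition _ := GRing.Zmodule_isPzRing.Build alg_quot
  aq_mulA aq_mul1r aq_mulr1 aq_mulDl aq_mulDr.

Lemma aq_scaleA a b v : aq_scale a (aq_scale b v) = aq_scale (a * b) v.
Proof. by elim/aq_ind: v => x; rewrite -!pi_aqZ scalerA. Qed.
Lemma aq_scale1 : left_id 1 aq_scale.
Proof. by elim/aq_ind=> x; rewrite -pi_aqZ scale1r. Qed.
Lemma aq_scaleDr : right_distributive aq_scale +%R.
Proof.
by move=> c; elim/aq_ind=> x; elim/aq_ind=> y; rewrite -pi_aqD -!pi_aqZ -pi_aqD scalerDr.
Qed.
Lemma aq_scaleDl v : {morph aq_scale^~ v : a b / a + b}.
Proof. by elim/aq_ind: v => x a b; rewrite -!pi_aqZ -pi_aqD scalerDl. Qed.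

HB.instance Definition _ := GRing.Zmodule_isLmodule.Build F alg_quot
  aq_scaleA aq_scale1 aq_scaleDr aq_scaleDl.

Lemma aq_scaleAl (a : F) (u v : alg_quot) : a *: (u * v) = a *: u * v.
Proof.
elim/aq_ind: u => x; elim/aq_ind: v => y.
change (aq_scale a (aq_mul (\pi_alg_quot x) (\pi_alg_quot y)) =
        aq_mul (aq_scale a (\pi_alg_quot x)) (\pi_alg_quot y)).
by rewrite -pi_aqM -!pi_aqZ -pi_aqM scalerAl.
Qed.
End TwoSidedQuotient.

(* P is meant to be a linear subspace of V; V itself may be infinite
   dimensional. *)
Definition has_dim (F : fieldType) (V : lmodType F) (P : V -> Prop) (d : nat) : Prop :=
  exists b : 'I_d -> V,
    (forall j, P (b j)) /\
    (forall v, P v -> exists! c : {ffun 'I_d -> F}, v = \sum_(j < d) c j *: b j).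

Section GraphAlgebra.
Variables (F : fieldType) (G : layered_graph).

Definition free_algebra := {malg F[{fmonom (edge G)}]}.
HB.instance Definition _ := GRing.Lalgebra.on free_algebra.

Definition gen (e : edge G) : free_algebra := << fmu e >>.

Definition is_path (e : edge G) (p : seq (edge G)) : bool :=
  path (fun e1 e2 => tail e2 == head e1) e p.

(* {poly R} for noncommutative R has central variable 'X, which is tau here. *)
Definition path_poly (p : seq (edge G)) : {poly free_algebra} :=
  \prod_(e <- p) ('X - (gen e)%:P).

Definition path_coef (p : seq (edge G)) (j : nat) : free_algebra :=
  (path_poly p)`_(size p - j).

(* A path is a nonempty sequence e :: p. *)
Definition relator (x : free_algebra) : Prop :=
  exists (e1 e2 : edge G) (p1 p2 : seq (edge G)) (k : nat),
    [/\ is_path e1 p1, is_path e2 p2,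
        tail e1 = tail e2, head (last e1 p1) = head (last e2 p2) &
        [/\ (1 <= k <= size (e1 :: p1))%N &
            x = path_coef (e1 :: p1) k - path_coef (e2 :: p2) k]].

Definition graph_alg := alg_quot relator.
HB.instance Definition _ := GRing.PzRing.on graph_alg.
HB.instance Definition _ := GRing.Lmodule.on graph_alg.

Definition free_homogeneous (i : nat) (x : free_algebra) : Prop :=
  forall w : {fmonom (edge G)}, x@_w != 0 -> fdeg w = i.

Definition graph_alg_homogeneous (i : nat) (a : graph_alg) : Prop :=
  exists2 x : free_algebra, free_homogeneous i x & a = \pi_(alg_quot relator) x.

Definition hilbert_function (h : nat -> nat) : Prop :=
  forall i, has_dim (graph_alg_homogeneous i) (h i).

End GraphAlgebra.

Section SubspaceGraph.
Variables (K : finFieldType) (n : nat).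

Definition covers (p : {vspace 'rV[K]_n} * {vspace 'rV[K]_n}) : bool :=
  (p.2 <= p.1)%VS && (\dim p.1 == (\dim p.2).+1).

Definition cover_edge := {p : {vspace 'rV[K]_n} * {vspace 'rV[K]_n} | covers p}.

Lemma dim_cover_edge (e : cover_edge) : \dim (val e).1 = (\dim (val e).2).+1.
Proof. by case: e => p /= /andP[_ /eqP]. Qed.

Definition subspace_graph : layered_graph :=
  @LayeredGraph {vspace 'rV[K]_n} cover_edge
    (fun e => (val e).1) (fun e => (val e).2) (fun U => \dim U) dim_cover_edge.

End SubspaceGraph.

(* A formal power series over rat is its coefficient sequence nat -> rat. *)
Definition fps_mul (f g : nat -> rat) (i : nat) : rat :=
  \sum_(j < i.+1) f j * g (i - j)%N.

Fixpoint fps_inv_seq (f : nat -> rat) (i : nat) : seq rat :=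
  if i is i'.+1 then
    let s := fps_inv_seq f i' in
    rcons s (- (f 0%N)^-1 * \sum_(j < i'.+1) f (i'.+1 - j)%N * s`_j)
  else [:: (f 0%N)^-1].

(* Meaningful only when f 0 != 0, see fps_mulV. *)
Definition fps_inv (f : nat -> rat) (i : nat) : rat := (fps_inv_seq f i)`_i.

Lemma size_fps_inv_seq f i : size (fps_inv_seq f i) = i.+1.
Proof. by elim: i => //= i IHi; rewrite size_rcons IHi. Qed.

Lemma nth_fps_inv_seq f i j : (j <= i)%N -> (fps_inv_seq f i)`_j = fps_inv f j.
Proof.
elim: i => [|i IHi]; first by rewrite leqn0 => /eqP ->.
rewrite leq_eqVlt => /predU1P[-> //|lt_ji].
by rewrite /= nth_rcons size_fps_inv_seq lt_ji IHi.
Qed.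

Lemma fps_mulV f : f 0%N != 0 ->
  forall i, fps_mul f (fps_inv f) i = (i == 0%N)%:R.
Proof.
move=> f0 [|i]; rewrite /fps_mul.
  by rewrite big_ord1 subnn /fps_inv /= mulfV.
rewrite big_ord_recl subn0 [fps_inv f i.+1]/fps_inv /=.
rewrite nth_rcons size_fps_inv_seq ltnn eqxx mulNr mulrN mulVKf //.
apply/eqP; rewrite addrC subr_eq0; apply/eqP.
rewrite (reindex_inj rev_ord_inj) /=; apply: eq_bigr => j _.
rewrite nth_fps_inv_seq -1?ltnS // /bump /= add1n subSS.
have lj := ltn_ord j; rewrite ltnS in lj.
by rewrite subSS subKn // subSn.
Qed.

Definition fps_div (f g : nat -> rat) : nat -> rat := fps_mul f (fps_inv g).

Definition fps_of_poly (p : {poly rat}) : nat -> rat := fun i => p`_i.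

(* Gaussian binomial; for m <= n and q > 1 no denominator vanishes. *)
Definition qbinom (q n m : nat) : rat :=
  \prod_(i < m) ((q%:R ^+ (n - i) - 1) / (q%:R ^+ i.+1 - 1)).

(* Main.v *)
(* Reversing tau into s = 1/tau, let E_v(s) = 1 + e(v,1) s + e(v,2) s^2 + ... be the product of
   the 1 - e s over the edges of a path from v to the bottom vertex. The algebra is generated
   by the e(v,k), 1 <= k <= |v|, and its relations say that E_v is right divisible by E_u, with
   a quotient of degree |v|-|u|, whenever v > u. The coefficients of the remainder of that
   division are rewriting rules with left-hand sides e(v,|v|-|u|) e(u,l). The rules decrease a
   weight, and their overlaps e(v,|v|-|u|) e(u,|u|-|w|) e(w,l) are resolved by comparing the
   division of E_v by E_w with the composite of the divisions of E_v by E_u and of E_u by E_w.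
   Hence the words without a factor e(v,|v|-|u|) e(u,l) form a basis.

   Let H and G_v be the generating functions of all these words and of those starting with a
   letter e(v,k). Then G_v = (t + ... + t^|v|) H - sum_(u < v) t^(|v|-|u|) G_u. In the
   subspace lattice the identity sum_j [d,j]_q t^(d-j) (1-t)...(1-tq^(j-1)) = 1 solves this
   system: (1-t) G_v = t ((1-t)...(1-tq^(|v|-1)) - [v = 0]) H. It remains to sum over v in
   H = 1 + sum_v G_v. *)

From HB Require Import structures.
From mathcomp Require Import all_boot all_order all_algebra all_field.
From mathcomp Require Import zify ring.
From mathcomp Require Import generic_quotient finmap.
From mathcomp.classical Require Import boolp.
From mathcomp.multinomials Require Import monalg.
Require Import Defs.

Set Implicit Arguments.
Unset Strict Implicit.
Unset Printing Implicit Defensive.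
Import Order.TTheory GRing.Theory Num.Theory.
Local Open Scope ring_scope.

(** * Free algebras and normal forms *)

(* Unifying products in the concrete monoid algebra unfolds its whole structure,
   so the free algebra is handled through this interface. *)
Record free_alg (F : fieldType) (A : choiceType) := FreeAlg {
  free_sort :> lalgType F;
  mon : seq A -> free_sort;
  coef : seq A -> free_sort -> F;
  monoms : free_sort -> seq (seq A);
  mon_nil : mon [::] = 1;
  mon_cat : forall s t, mon (s ++ t) = mon s * mon t;
  free_scalerAr : forall (c : F) (p q : free_sort), c *: (p * q) = p * (c *: q);
  coef_is_linear : forall s, scalar (coef s);
  coef_mon : forall s t, coef s (mon t) = (s == t)%:R;
  monoms_uniq : forall p, uniq (monoms p);
  mon_expand : forall p, p = \sum_(s <- monoms p) coef s p *: mon s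
}.
Arguments mon {F A f}.
Arguments coef {F A f}.

Section FreeAlgebra.
Variables (F : fieldType) (A : choiceType) (T : free_alg F A).
Implicit Types (p q : T) (s t : seq A).

HB.instance Definition _ s :=
  GRing.isLinear.Build F T F *%R (coef s) (@coef_is_linear F A T s).

Lemma coefP s c p q : coef s (c *: p + q) = c * coef s p + coef s q.
Proof. exact: coef_is_linear. Qed.

Lemma coef_notin s p : s \notin monoms p -> coef s p = 0.
Proof.
move=> sp; rewrite {1}(mon_expand p) linear_sum big1_seq // => t /= tp.
rewrite linearZ /= coef_mon; case: eqP => [est|]; last by rewrite mulr0.
by rewrite est tp in sp.
Qed.

Lemma free_ind (P : T -> Prop) :
  P 0 -> (forall c s p, P p -> P (c *: mon s + p)) -> forall p, P p.
Proof.
move=> P0 PD p; rewrite (mon_expand p); elim: (monoms p) => [|s r IHr].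
  by rewrite big_nil.
by rewrite big_cons; apply: PD.
Qed.

Lemma coef_inj p q : (forall s, coef s p = coef s q) -> p = q.
Proof.
move=> pq; apply/eqP; rewrite -subr_eq0; apply/eqP.
rewrite (mon_expand (p - q)) big1 // => s _.
by rewrite linearB /= pq subrr scale0r.
Qed.

Definition supp (C : seq A -> Prop) p := forall s, coef s p != 0 -> C s.

Lemma suppW (C D : seq A -> Prop) p :
  (forall s, C s -> D s) -> supp C p -> supp D p.
Proof. by move=> CD Cp s /Cp /CD. Qed.

Lemma supp0 C : supp C 0.
Proof. by move=> s; rewrite linear0 eqxx. Qed.

Lemma suppP C c p q : supp C p -> supp C q -> supp C (c *: p + q).
Proof.
move=> Cp Cq s; rewrite coefP; have [/Cp//|] := boolP (coef s p != 0).
by rewrite negbK => /eqP->; rewrite mulr0 add0r; apply: Cq.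
Qed.

Lemma suppD C p q : supp C p -> supp C q -> supp C (p + q).
Proof. by move=> Cp Cq; rewrite -[p]scale1r; apply: suppP. Qed.

Lemma suppZ C c p : supp C p -> supp C (c *: p).
Proof. by move=> Cp; rewrite -[_ *: _]addr0; apply: suppP => //; apply: supp0. Qed.

Lemma suppN C p : supp C p -> supp C (- p).
Proof. by move=> Cp; rewrite -scaleN1r; apply: suppZ. Qed.

Lemma suppB C p q : supp C p -> supp C q -> supp C (p - q).
Proof. by move=> Cp Cq; apply: suppD => //; apply: suppN. Qed.

Lemma supp_sum C (I : eqType) (r : seq I) (P : pred I) (f : I -> T) :
  (forall i, i \in r -> P i -> supp C (f i)) -> supp C (\sum_(i <- r | P i) f i).
Proof.
move=> Cf; rewrite big_seq_cond; elim/big_ind: _ => [||i /andP[]]; last exact: Cf.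
  exact: supp0.
exact: suppD.
Qed.

Lemma supp_mon (C : seq A -> Prop) s : C s -> supp C (mon s).
Proof. by move=> Cs t; rewrite coef_mon; case: (t =P s) => [->|_]; rewrite ?eqxx. Qed.

Lemma supp_ind C (P : T -> Prop) : P 0 ->
  (forall c s p, C s -> P p -> P (c *: mon s + p)) -> forall p, supp C p -> P p.
Proof.
move=> P0 PD p Cp; rewrite (mon_expand p); elim: (monoms p) => [|s r IHr].
  by rewrite big_nil.
rewrite big_cons; have [->|/Cp Cs] := eqVneq (coef s p) 0; last exact: PD.
by rewrite scale0r add0r.
Qed.

Lemma suppM (C D E : seq A -> Prop) p q :
  (forall s t, C s -> D t -> E (s ++ t)) -> supp C p -> supp D q -> supp E (p * q).
Proof.
move=> CDE Cp Dq; elim/supp_ind: p / Cp => [|c s p Cs IHp].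
  by rewrite mul0r; apply: supp0.
rewrite mulrDl -scalerAl; apply: suppP => // {IHp}.
elim/supp_ind: q / Dq => [|d t q Dt IHq]; first by rewrite mulr0; apply: supp0.
rewrite mulrDr -free_scalerAr; apply: suppP => //.
by rewrite -mon_cat; apply: supp_mon; apply: CDE.
Qed.

Lemma coef_combination (ws : seq (seq A)) c s : uniq ws ->
  coef s (\sum_(t <- ws) c t *: mon t : T) = if s \in ws then c s else 0.
Proof.
move=> uws; rewrite linear_sum; case: ifP => sw.
  rewrite (bigD1_seq s) //= linearZ /= coef_mon eqxx mulr1 big1 ?addr0 // => t ts.
  by rewrite linearZ /= coef_mon eq_sym (negbTE ts) mulr0.
rewrite big1_seq // => t /= tw; rewrite linearZ /= coef_mon.
by case: eqP => [st|_]; [rewrite st tw in sw|rewrite mulr0].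
Qed.

Lemma supp_expand (ws : seq (seq A)) p : uniq ws -> supp (fun s => s \in ws) p ->
  p = \sum_(s <- ws) coef s p *: mon s.
Proof.
move=> uws pw; apply: coef_inj => s; rewrite (coef_combination (coef^~ p)) //.
by case: ifP => // sw; apply/eqP/contraT => /pw; rewrite sw.
Qed.

Section LinearExtension.
Variable V : lmodType F.
Implicit Types f g : seq A -> V.

Definition lin f p : V := \sum_(s <- monoms p) coef s p *: f s.

(** Linearity compares sums over the supports of [p], [q] and [c *: p + q], which calls for a common
    longer list. *)
Lemma lin_wide (d : seq (seq A)) f p : uniq d -> {subset monoms p <= d} ->
  lin f p = \sum_(s <- d) coef s p *: f s.
Proof.
move=> ud sd; rewrite [RHS](bigID [in monoms p]) /= [X in _ + X]big1 => [|s]; last first.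
  by move/coef_notin->; rewrite scale0r.
rewrite addr0 -big_filter; apply/perm_big/uniq_perm => [||s].
- exact: monoms_uniq.
- exact: filter_uniq.
by rewrite mem_filter; case: (boolP (s \in monoms p)) => // /sd ->.
Qed.

Lemma lin_is_linear f : linear (lin f).
Proof.
move=> c p q; pose d := undup (monoms p ++ monoms q ++ monoms (c *: p + q)).
have ud : uniq d by apply: undup_uniq.
have sp : {subset monoms p <= d} by move=> s; rewrite mem_undup !mem_cat => ->.
have sq : {subset monoms q <= d}.
  by move=> s; rewrite mem_undup !mem_cat => ->; rewrite orbT.
have sr : {subset monoms (c *: p + q) <= d}.
  by move=> s; rewrite mem_undup !mem_cat => ->; rewrite !orbT.
rewrite (lin_wide f ud sp) (lin_wide f ud sq) (lin_wide f ud sr).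
rewrite scaler_sumr -big_split /=; apply: eq_bigr => s _.
by rewrite coefP scalerDl scalerA.
Qed.
HB.instance Definition _ f := GRing.isLinear.Build F T V *:%R (lin f) (lin_is_linear f).

Lemma lin0 f : lin f 0 = 0.
Proof. exact: linear0. Qed.

Lemma linP f c p q : lin f (c *: p + q) = c *: lin f p + lin f q.
Proof. exact: linearP. Qed.

Lemma lin_mon f s : lin f (mon s) = f s.
Proof.
have sub : {subset monoms (mon s : T) <= undup (s :: monoms (mon s : T))}.
  by move=> t; rewrite mem_undup inE orbC => ->.
rewrite (lin_wide f (undup_uniq _) sub) (bigD1_seq s) ?undup_uniq ?mem_undup ?mem_head //= coef_mon eqxx scale1r.
by rewrite big1 ?addr0 // => t /negbTE ts; rewrite coef_mon ts scale0r.
Qed.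

Lemma eq_lin C f g p :
  supp C p -> (forall s, C s -> f s = g s) -> lin f p = lin g p.
Proof.
move=> Cp fg; elim/supp_ind: p / Cp => [|c s p Cs IHp]; first by rewrite !lin0.
by rewrite !linP IHp !lin_mon fg.
Qed.

End LinearExtension.

End FreeAlgebra.

Lemma supp_lin (F : fieldType) (A B : choiceType) (T : free_alg F A)
    (U : free_alg F B) (C : seq A -> Prop) (D : seq B -> Prop) (f : seq A -> U) (p : T) :
  (forall s, C s -> supp D (f s)) -> supp C p -> supp D (lin f p).
Proof.
move=> CD Cp; elim/supp_ind: p / Cp => [|c s p Cs IHp]; first by rewrite lin0; apply: supp0.
by rewrite linP lin_mon; apply: suppP => //; apply: CD.
Qed.

(** * Algebra morphisms determined by the images of the letters *)

Section WordMap.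
Variables (F : fieldType) (A B : choiceType) (T : free_alg F A) (U : free_alg F B).
Variable g : A -> U.

Definition wmap : T -> U := lin (fun s => \prod_(a <- s) g a).
HB.instance Definition _ := GRing.Linear.on wmap.

Lemma wmap_mon s : wmap (mon s) = \prod_(a <- s) g a.
Proof. exact: lin_mon. Qed.

Lemma wmap_is_monoid : monoid_morphism wmap.
Proof.
split=> [|p q]; first by rewrite -mon_nil wmap_mon big_nil.
elim/free_ind: p => [|c s p IHp]; first by rewrite mul0r !linear0 mul0r.
rewrite mulrDl -scalerAl !linearP /= IHp mulrDl -scalerAl; congr (_ *: _ + _).
elim/free_ind: q {IHp} => [|d t q IHq]; first by rewrite mulr0 !linear0 mulr0.
rewrite mulrDr -free_scalerAr !linearP /= IHq mulrDr -free_scalerAr -mon_cat.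
by rewrite !wmap_mon big_cat.
Qed.
HB.instance Definition _ := GRing.isMonoidMorphism.Build T U wmap wmap_is_monoid.

End WordMap.

(** * Normal forms for weight-decreasing rules on adjacent letters *)

Section Reduction.
Variables (F : fieldType) (A : choiceType) (T : free_alg F A).
Variables (deg wt : A -> nat) (cov : rel A).
Variable rule : A -> A -> T.

Definition sdeg (s : seq A) : nat := \sum_(a <- s) deg a.
Definition swt (s : seq A) : nat := \sum_(a <- s) wt a.
Definition bnd d m (s : seq A) := sdeg s = d /\ (swt s <= m)%N.
Definition normal := sorted (fun a b => ~~ cov a b).

Hypothesis rule_lt : forall a b, cov a b ->
  supp (fun s => sdeg s = deg a + deg b /\ swt s < wt a + wt b)%N (rule a b).

(** One step, always at the leftmost reducible pair. Fixing the position makes the normal form a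
    function of the word before any confluence is known. *)
Fixpoint red (s : seq A) : T :=
  match s with
  | a :: (b :: s2) as s1 =>
    if cov a b then rule a b * mon s2 else mon [:: a] * red s1
  | _ => mon s
  end.

Lemma red_cons a b s :
  red (a :: b :: s) = if cov a b then rule a b * mon s else mon [:: a] * red (b :: s).
Proof. by []. Qed.

Lemma red_supp s : ~~ normal s ->
  supp (fun t => sdeg t = sdeg s /\ swt t < swt s)%N (red s).
Proof.
elim: s => [|a [|b s] IHs] //=; have [ab _|/= Nab /IHs H] := ifP.
  apply: (suppM (D := eq s) _ (rule_lt ab)) => [t _ [dt wt_t] <-|]; last exact: supp_mon.
  by rewrite /sdeg /swt !big_cons !big_cat -/(sdeg t) -/(swt t) dt !addnA ltn_add2r.
apply: (suppM (C := eq [:: a]) _ _ H) => [_ t <- [dt wt_t]|]; last exact: supp_mon.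
by rewrite /sdeg /swt !(big_cons _ _ a) -/(sdeg t) -/(swt t) dt ltn_add2l.
Qed.

Lemma red_cat s t : ~~ normal s -> red (s ++ t) = red s * mon t.
Proof.
elim: s => [|a [|b s] IHs] //=; case: ifP => [_ _|_ /= /IHs].
  by rewrite -mulrA -mon_cat.
by rewrite -mulrA => <-.
Qed.

Lemma red_last s a b : normal (rcons s a) -> cov a b ->
  red (s ++ [:: a; b]) = mon s * rule a b.
Proof.
move=> + ab; elim: s => [|c s IHs]; first by rewrite /= ab mon_nil mulr1 mul1r.
case: s IHs => [_|d s IHs ns]; last have /andP[/negbTE Ncd /IHs H] := ns.
  by rewrite /= andbT => /negbTE->; rewrite ab mon_nil mulr1.
by rewrite !cat_cons red_cons Ncd -cat_cons H mulrA -mon_cat.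
Qed.

(** Each step lowers the weight, so the weight of a word is enough fuel. The value 0 on exhaustion
    is then correct: a word of weight 0 that is not normal reduces to 0. *)
Fixpoint nform_fuel m (s : seq A) : T :=
  if normal s then mon s
  else if m is m'.+1 then lin (nform_fuel m') (red s) else 0.

Lemma nform_fuel_stable m n s :
  (swt s <= m)%N -> (swt s <= n)%N -> nform_fuel m s = nform_fuel n s.
Proof.
elim: m n s => [|m IHm] n s lem len.
  have [ns|nns] := boolP (normal s); first by case: n len => [|n] /=; rewrite ns.
  rewrite /= (negbTE nns); case: n len => [|n] len /=; rewrite (negbTE nns) //.
  rewrite (@eq_lin _ _ _ _ (fun=> False) _ (fun=> 0) (red s)) //.
    by rewrite /lin big1 // => i _; rewrite scaler0.
  by apply: suppW (red_supp nns) => t []; lia.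
have [ns|nns] := boolP (normal s); first by case: n len => [|n] /=; rewrite ns.
case: n len => [|n] len; rewrite /= (negbTE nns).
  rewrite (@eq_lin _ _ _ _ (fun=> False) _ (fun=> 0) (red s)) //.
    by rewrite /lin big1 // => i _; rewrite scaler0.
  by apply: suppW (red_supp nns) => t []; lia.
apply: (eq_lin (red_supp nns)) => t [_ tlt].
by apply: IHm; lia.
Qed.

Definition nform : T -> T := lin (fun s => nform_fuel (swt s) s).
HB.instance Definition _ := GRing.Linear.on nform.

Lemma nform_normal s : normal s -> nform (mon s) = mon s.
Proof. by move=> ns; rewrite /nform lin_mon; case: (swt s) => [|m] /=; rewrite ns. Qed.

Lemma nform_red s : ~~ normal s -> nform (mon s) = nform (red s).
Proof.
move=> nns; rewrite {1}/nform lin_mon (@nform_fuel_stable _ (swt s).+1) //=.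
rewrite (negbTE nns); apply: (eq_lin (red_supp nns)) => t [_ tlt].
by apply: nform_fuel_stable => //; lia.
Qed.

Lemma nform_ind (P : seq A -> Prop) :
  (forall s, normal s -> P s) ->
  (forall s, ~~ normal s -> supp P (red s) -> P s) -> forall s, P s.
Proof.
move=> Pn Pr s; have [m] := ubnP (swt s); elim: m s => // m IHm s lem.
have [/Pn//|nns] := boolP (normal s); apply: Pr => //.
by apply: suppW (red_supp nns) => t [_ tlt]; apply: IHm; lia.
Qed.

(** The leftmost strategy rewrites a reducible left factor before it touches the right one, so both
    sides follow the same reductions. This holds before any overlap is resolved. *)
Lemma nformK (p q : T) : nform (nform p * q) = nform (p * q).
Proof.
elim/free_ind: p => [|c s p IHp]; first by rewrite linear0 !mul0r.
rewrite linearP /= !mulrDl -!scalerAl !linearP /= IHp; congr (_ *: _ + _).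
elim/free_ind: q {p IHp} => [|d t q IHq]; first by rewrite !mulr0.
rewrite !mulrDr -!free_scalerAr !linearP /= IHq; congr (_ *: _ + _).
elim/nform_ind: s {IHq} => s; first by move/nform_normal->.
move=> nns IHs; rewrite nform_red // -mon_cat [RHS]nform_red => [|]; last first.
  by apply: contra nns; rewrite /normal; case: (s) => //= a u; rewrite cat_path => /andP[].
rewrite red_cat //; elim/supp_ind: (red s) / IHs => [|e u p IHu IHp].
  by rewrite linear0 !mul0r.
by rewrite linearP /= !mulrDl -!scalerAl !linearP /= IHu IHp.
Qed.

Lemma nform_supp s :
  supp (fun t => normal t /\ bnd (sdeg s) (swt s) t) (nform (mon s)).
Proof.
elim/nform_ind: s => s; first by move=> ns; rewrite nform_normal //; apply: supp_mon.
move=> nns IHs; rewrite nform_red //.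
have {IHs}: supp (fun t => supp (fun u => normal u /\ bnd (sdeg s) (swt s) u)
    (nform (mon t))) (red s).
  move=> u cu; have [du wtu] := red_supp nns cu.
  apply: suppW (IHs u cu) => v [nv [dv wtv]]; split=> //; split; first by rewrite dv.
  by apply: leq_trans wtv (ltnW wtu).
move=> C; elim/supp_ind: (red s) / C => [|c u p Cu IHp]; first by rewrite linear0; apply: supp0.
by rewrite linearP; apply: suppP.
Qed.

(** The last pair is the only reducible one, so the leftmost strategy applies exactly this rule. *)
Lemma nform_last s a b : normal (rcons s a) -> cov a b ->
  nform (mon s * (mon [:: a; b] - rule a b)) = 0.
Proof.
move=> ns ab; rewrite mulrBr -mon_cat linearB /= nform_red ?red_last ?subrr //.
rewrite /normal -cat_rcons; case: s ns => [|c s] _ /=; first by rewrite ab.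
by rewrite cat_path last_rcons /= ab andbF.
Qed.

Lemma bnd_cat d m d' m' s t : bnd d m s -> bnd d' m' t -> bnd (d + d') (m + m') (s ++ t).
Proof.
case=> <- ws [<- wtt]; split; first by rewrite /sdeg big_cat.
by rewrite /swt big_cat leq_add.
Qed.

End Reduction.

(** * Division of the series of a ranked poset *)

Section SeriesDivision.
Variable R : nzRingType.
Implicit Types A P S : {poly R}.

(** For [P] with constant term 1 this is the power series A P^(-1) truncated after degree [k]: each
    new coefficient kills the next coefficient of the remainder. *)
Fixpoint squo A P k : {poly R} :=
  if k is k'.+1 then
    let Q := squo A P k' in Q + ((A - Q * P)`_k)%:P * 'X^k
  else (A`_0)%:P.

Lemma squo_coef0 A P k i : (k < i)%N -> (squo A P k)`_i = 0.
Proof.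
elim: k => [|k IHk] ltki /=; first by rewrite coefC gtn_eqF.
by rewrite coefD IHk ?(ltnW ltki) // coefCM coefXn gtn_eqF // mulr0 addr0.
Qed.

Lemma squoP A P k i : P`_0 = 1 -> (i <= k)%N -> (A - squo A P k * P)`_i = 0.
Proof.
move=> P0; elim: k i => [|k IHk] i leik /=.
  by case: i leik => // _; rewrite coefB coefM big_ord1 subn0 coefC /= P0 mulr1 subrr.
rewrite mulrDl opprD addrA coefB -mulrA -commr_polyXn mulrA coefMXn.
have [ltik|leki] := ltnP; first by rewrite IHk // subr0.
have -> : i = k.+1 by apply/eqP; rewrite eqn_leq leik.
by rewrite subnn coefCM P0 mulr1 subrr.
Qed.

Section RightIdeal.
Variable K : R -> Prop.
Hypothesis KB : forall x y, K x -> K y -> K (x - y).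
Hypothesis KM : forall x z, K x -> K (x * z).

Lemma right_ideal_sum (I : finType) (Q : pred I) (f : I -> R) :
  K 0 -> (forall i, Q i -> K (f i)) -> K (\sum_(i | Q i) f i).
Proof.
move=> K0 Kf; elim/big_ind: _ => // x y Kx Ky.
by rewrite -[y]opprK; apply: (KB) => //; rewrite -sub0r; apply: (KB).
Qed.

(** A series with constant term 1 is invertible on the right, and a right ideal absorbs the inverse;
    the induction solves for one coefficient of [S] at a time. *)
Lemma series_cancel S P m : K 0 -> P`_0 = 1 ->
  (forall i, (i <= m)%N -> K (S * P)`_i) -> forall i, (i <= m)%N -> K S`_i.
Proof.
move=> K0 P0 KSP; elim/ltn_ind => i IHi leim.
have := KSP i leim; rewrite coefM big_ord_recr /= subnn P0 mulr1.
set s := \sum_(j < i) _ => Ks; rewrite -[S`_i](addKr s) addrC; apply: (KB) => //.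
apply: right_ideal_sum => // j _; apply: (KM); apply: IHi => //.
by apply: leq_trans leim; apply: ltnW.
Qed.
End RightIdeal.
End SeriesDivision.

(* Each of the k levels l, l-1, ..., l-k+1 crossed by a letter counts twice, and the letter
   itself once: sum_(i < k) 2 * (l - i) + 1. Replacing two letters by one that crosses the
   same levels, or crossing lower levels, then decreases the weight. *)
Definition lweight (l k : nat) : nat := (k * (2 * l + 1 - k)).+1.

Lemma lweightE k m : lweight (k + m) k = (k * (k + 2 * m + 1)).+1.
Proof. by rewrite /lweight; congr (_ * _).+1; lia. Qed.

Lemma lweight_ltn l i j : (i < j)%N -> (j <= l)%N -> (lweight l i < lweight l j)%N.
Proof.
move=> ij jl; have -> : l = (i + ((j - i) + (l - j)))%N by lia.
rewrite lweightE addnA; have -> : (i + (j - i) = j)%N by lia.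
by rewrite lweightE; nia.
Qed.

Lemma lweight_leq l i j : (i <= j)%N -> (j <= l)%N -> (lweight l i <= lweight l j)%N.
Proof.
by rewrite leq_eqVlt => /predU1P[->//|ij jl]; apply/ltnW/lweight_ltn.
Qed.

(** Compares the single letter e(v,|v|-|u|+l) in a rule with the left-hand side of that rule. *)
Lemma lweight_merge lv lu l : (lu <= lv)%N -> (l <= lu)%N ->
  (lweight lv (lv - lu + l) < lweight lv (lv - lu) + lweight lu l)%N.
Proof.
move=> uv llu; pose k := (lv - lu)%N; pose m := (lu - l)%N.
have e1 : lweight lv (lv - lu + l) = ((k + l) * ((k + l) + 2 * m + 1)).+1.
  by rewrite -lweightE; congr lweight; lia.
have e2 : lweight lv (lv - lu) = (k * (k + 2 * (l + m) + 1)).+1.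
  by rewrite -lweightE; congr lweight; lia.
have e3 : lweight lu l = (l * (l + 2 * m + 1)).+1.
  by rewrite -lweightE; congr lweight; lia.
rewrite e1 e2 e3; nia.
Qed.

(** Bounds the corrections in the recursion for quotient coefficients: e(v,j) e(u,i-j) lies below
    e(v,i). *)
Lemma lweight_split lv lu i j : (j < i)%N -> (i <= lv - lu)%N -> (i - j <= lu)%N ->
  (lweight lv j + lweight lu (i - j) < lweight lv i)%N.
Proof.
move=> ji ik dl; pose d := (i - j)%N; pose e := (lv - lu - i)%N; pose m := (lu - d)%N.
have e1 : lweight lv j = (j * (j + 2 * (2 * d + e + m) + 1)).+1.
  by rewrite -lweightE; congr lweight; lia.
have e2 : lweight lu (i - j) = (d * (d + 2 * m + 1)).+1.
  by rewrite -lweightE; congr lweight; lia.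
have e3 : lweight lv i = ((j + d) * ((j + d) + 2 * (d + e + m) + 1)).+1.
  by rewrite -lweightE; congr lweight; lia.
have d0 : (0 < d)%N by lia.
rewrite e1 e2 e3; nia.
Qed.

(** Degree moved from the first letter to the second crosses lower levels, hence weighs less. This
    orders the two-letter words of a remainder coefficient. *)
Lemma lweight_shift lv lu i j k l :
  (i < k)%N -> (k <= lv - lu)%N -> (i + j <= k + l)%N -> (j <= lu)%N -> (l <= lu)%N ->
  (lweight lv i + lweight lu j < lweight lv k + lweight lu l)%N.
Proof.
move=> ik kl ijkl jlu llu.
have [jl|lj] := leqP j l.
  have := lweight_leq jl llu; have : (lweight lv i < lweight lv k)%N; last by lia.
  by apply: lweight_ltn => //; lia.
(* In the slacks [d], [f], [e], [m] the truncated subtractions disappear and all weights become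
   polynomials. *)
pose d := (k - i)%N; pose f := (j - l)%N; pose e := (lv - lu - k)%N; pose m := (lu - j)%N.
have e1 : lweight lv i = (i * (i + 2 * (d + e + l + f + m) + 1)).+1.
  by rewrite -lweightE; congr lweight; lia.
have e2 : lweight lu j = ((l + f) * ((l + f) + 2 * m + 1)).+1.
  by rewrite -lweightE; congr lweight; lia.
have e3 : lweight lv k = ((i + d) * ((i + d) + 2 * (e + l + f + m) + 1)).+1.
  by rewrite -lweightE; congr lweight; lia.
have e4 : lweight lu l = (l * (l + 2 * (f + m) + 1)).+1.
  by rewrite -lweightE; congr lweight; lia.
have d0 : (0 < d)%N by lia.
have fd : (f <= d)%N by lia.
(* The first weight drops by [d * X] and the second rises by [f * Y], where [f <= d] and [Y < X]. *)
pose X := (2 * (l + f + m) + 1 + 2 * e + d)%N; pose Y := (f + 2 * m + 1)%N.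
have fY : (f * Y < d * X)%N.
  apply: leq_ltn_trans (leq_mul fd (leqnn Y)) _.
  by rewrite ltn_pmul2l // /X /Y; lia.
have : (lweight lv i + lweight lu j + d * X = lweight lv k + lweight lu l + f * Y)%N.
  by rewrite e1 e2 e3 e4 /X /Y; lia.
by lia.
Qed.

(** * Rewriting rules from the remainders of the division *)

Section Poset.
Variables (F : fieldType) (V : choiceType) (lev : V -> nat) (gt : rel V).
Hypothesis gt_trans : transitive gt.
Hypothesis gt_lev : forall v u, gt v u -> (lev u < lev v)%N.

(** The pair (v,k) stands for the generator e(v,k). *)
Definition letter := {a : V * nat | 0 < a.2 <= lev a.1}%N.
Implicit Types (a b c : letter) (x s : seq letter).
Variable T : free_alg F letter.

(* So ltr v 0 = 1, and ltr v i = 0 for i > lev v. *)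
Definition ltr v i : T := oapp (fun a : letter => mon [:: a]) (i == 0)%:R (insub (v, i)).

Lemma ltr0 v : ltr v 0 = 1.
Proof. by rewrite /ltr insubF. Qed.

Lemma ltr_letter (a : letter) : ltr (val a).1 (val a).2 = mon [:: a].
Proof. by rewrite /ltr -surjective_pairing valK. Qed.

Lemma ltr_big v i : (lev v < i)%N -> ltr v i = 0.
Proof.
move=> lvi; rewrite /ltr insubF /=; last by rewrite [(i <= _)%N]leqNgt lvi andbF.
by rewrite gtn_eqF //; case: i lvi.
Qed.

Definition ldeg a := (val a).2.
Definition lwt a := lweight (lev (val a).1) (val a).2.
Definition cov a b :=
  gt (val a).1 (val b).1 && ((val a).2 == lev (val a).1 - lev (val b).1)%N.

Local Notation bnd := (bnd ldeg lwt).

(** With free letters as coefficients, this and the next two definitions are the series E_v, its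
    right quotient by E_u up to degree |v|-|u|, and the remainder. *)
Definition vser v : {poly T} := \poly_(i < (lev v).+1) ltr v i.
Definition vquo v u : {poly T} := squo (vser v) (vser u) (lev v - lev u).
Definition vrem v u : {poly T} := vser v - vquo v u * vser u.

Lemma coef_vser v i : (vser v)`_i = ltr v i.
Proof. by rewrite coef_poly; case: ltnP => // lvi; rewrite ltr_big. Qed.

Lemma vser0 v : (vser v)`_0 = 1.
Proof. by rewrite coef_vser ltr0. Qed.

Lemma vquo_big v u i : (lev v - lev u < i)%N -> (vquo v u)`_i = 0.
Proof. exact: squo_coef0. Qed.

Lemma vrem_small v u i : (i <= lev v - lev u)%N -> (vrem v u)`_i = 0.
Proof. exact/squoP/vser0. Qed.

(** Both E_v and the product of the quotient with E_u have degree at most |v|. With [vrem_small],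
    the remainder lives in the degrees |v|-|u|+l with 1 <= l <= |u|, one for each letter of [u]. *)
Lemma vrem_big v u i : gt v u -> (lev v < i)%N -> (vrem v u)`_i = 0.
Proof.
move=> /gt_lev uv lvi; rewrite coefB coef_vser ltr_big // sub0r coefM big1 ?oppr0 // => j _.
have [jk|kj] := leqP j (lev v - lev u); last by rewrite vquo_big ?mul0r.
by rewrite coef_vser ltr_big ?mulr0 //; lia.
Qed.

Lemma supp_bndW d d' m m' (p : T) : d = d' -> (m <= m')%N ->
  supp (bnd d m) p -> supp (bnd d' m') p.
Proof.
by move=> <- mm'; apply: suppW => s [ds ws]; split=> //; apply: leq_trans mm'.
Qed.

Lemma supp_bndM d m d' m' (p q : T) :
  supp (bnd d m) p -> supp (bnd d' m') q -> supp (bnd (d + d') (m + m')) (p * q).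
Proof. by apply: suppM => s t; apply: bnd_cat. Qed.

Lemma ltr_bnd v i : supp (bnd i (lweight (lev v) i)) (ltr v i).
Proof.
rewrite /ltr; case: insubP => [a _ eva|_] /=.
  by apply: supp_mon; rewrite /bnd /sdeg /swt !big_seq1 /ldeg /lwt eva.
case: eqP => [->|_]; last exact: supp0.
by rewrite -mon_nil; apply: supp_mon; rewrite /bnd /sdeg /swt !big_nil.
Qed.

Lemma vquoE v u i : (i <= lev v - lev u)%N ->
  (vquo v u)`_i = ltr v i - \sum_(j < i) (vquo v u)`_j * ltr u (i - j)%N.
Proof.
move=> ik; apply/eqP; rewrite eq_sym subr_eq eq_sym -subr_eq0.
have := vrem_small ik; rewrite coefB coef_vser coefM big_ord_recr /=.
rewrite coef_vser subnn ltr0 mulr1 [X in _ - X]addrC => H.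
rewrite -oppr_eq0 opprB -[X in _ == X]H; apply/eqP; congr (_ - (_ + _)).
by apply: eq_bigr => j _; rewrite coef_vser.
Qed.

(** The quotient coefficient is e(v,i) plus words of smaller weight: in [vquoE] the corrections are
    bounded by induction and [lweight_split]. *)
Lemma vquo_bnd v u i : (i <= lev v - lev u)%N ->
  supp (bnd i (lweight (lev v) i).-1) ((vquo v u)`_i - ltr v i) /\
  supp (bnd i (lweight (lev v) i)) (vquo v u)`_i.
Proof.
elim/ltn_ind: i => i IHi ik.
have H : supp (bnd i (lweight (lev v) i).-1) ((vquo v u)`_i - ltr v i).
  rewrite vquoE // addrAC subrr add0r; apply: suppN; apply: supp_sum => j _ _.
  have [dl|ld] := leqP (i - j) (lev u); last by rewrite ltr_big // mulr0; apply: supp0.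
  have ji := ltn_ord j; have [_ Bj] := IHi j ji (ltnW (leq_trans ji ik)).
  apply: supp_bndW _ _ (supp_bndM Bj (@ltr_bnd u (i - j)%N)); first by lia.
  by have := lweight_split ji ik dl; lia.
split=> //; rewrite -[_`_i](subrK (ltr v i)); apply: suppD; last exact: ltr_bnd.
by apply: supp_bndW _ _ H => //; apply: leq_pred.
Qed.

Definition lead_wt v u l := (lweight (lev v) (lev v - lev u) + lweight (lev u) l)%N.

(** Up to smaller weight the remainder coefficient is minus the word e(v,|v|-|u|) e(u,l). What has
    to be bounded is the letter of E_v, the lower part of the top quotient coefficient, and the
    products with the other quotient coefficients. *)
Lemma vrem_bnd v u l : gt v u -> (0 < l <= lev u)%N ->
  supp (bnd (lev v - lev u + l) (lead_wt v u l).-1)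
    (ltr v (lev v - lev u)%N * ltr u l + (vrem v u)`_(lev v - lev u + l)).
Proof.
move=> /gt_lev uv /andP[l0 llu]; set k := (lev v - lev u)%N.
have W0 : (0 < lead_wt v u l)%N by [].
rewrite coefB coef_vser coefM addrCA; apply: suppD.
  apply: supp_bndW _ _ (@ltr_bnd v _) => //; have := lweight_merge (ltnW uv) llu; rewrite /lead_wt -/k; lia.
have kl : (k < (k + l).+1)%N by lia.
rewrite (bigD1 (Ordinal kl)) //= coef_vser addKn opprD addrA -mulrBl.
apply: suppB.
  rewrite -[_ - _]opprB mulNr; apply: suppN.
  by have [B _] := vquo_bnd (leqnn k); apply: supp_bndW _ _ (supp_bndM B (@ltr_bnd u l)) => //.
apply: supp_sum => j _ jk; have {}jk : (j : nat) != k by [].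
rewrite coef_vser.
have [ltjk|ltkj|ejk] := ltngtP (j : nat) k; first last.
- by rewrite ejk eqxx in jk.
- by rewrite vquo_big // mul0r; apply: supp0.
have [dl|ld] := leqP (k + l - j) (lev u); last by rewrite ltr_big // mulr0; apply: supp0.
have [_ B] := vquo_bnd (ltnW ltjk).
apply: supp_bndW _ _ (supp_bndM B (@ltr_bnd u _)); first by lia.
have jkl : (j + (k + l - j) <= k + l)%N by lia.
exact: (lweight_shift ltjk (leqnn _ : k <= lev v - lev u)%N jkl dl llu).
Qed.

(** The leading word of the remainder coefficient has sign -1, so adding [mon [:: a; b]] cancels it;
    rewriting by the rule sets that coefficient to 0. *)
Definition rule a b : T :=
  mon [:: a; b] + (vrem (val a).1 (val b).1)`_((val a).2 + (val b).2).

Lemma rule_lt a b : cov a b ->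
  supp (fun s => sdeg ldeg s = ldeg a + ldeg b /\ swt lwt s < lwt a + lwt b)%N (rule a b).
Proof.
case/andP=> ab /eqP ka; have := vrem_bnd ab (valP b).
rewrite -{1 2 3}ka !ltr_letter -mon_cat; apply: suppW => s [ds ws]; split=> //.
by apply: leq_ltn_trans ws _; rewrite /lead_wt -ka.
Qed.

Definition nf : T -> T := nform lwt cov rule.
HB.instance Definition _ := GRing.Linear.on nf.

Lemma nfK (p q : T) : nf (nf p * q) = nf (p * q).
Proof. exact: nformK rule_lt p q. Qed.

Lemma nf_kill (p q : T) : nf p = 0 -> nf (p * q) = 0.
Proof. by move=> p0; rewrite -nfK p0 mul0r linear0. Qed.

(* Comparing the division of v by w with the one through u: this resolves the overlaps. *)
Lemma overlap_identity v u w :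
  (vquo v w - vquo v u * vquo u w) * vser w =
  vrem v u + vquo v u * vrem u w - vrem v w.
Proof.
have tele (M : zmodType) (a b c d : M) : d - c = a - b + (b - c) - (a - d).
  by rewrite addrA subrK opprB [RHS]addrC addrA subrK.
by rewrite /vrem mulrBl mulrBr mulrA; apply: tele.
Qed.

Lemma normal_rcons_cov x a : normal cov x -> ~~ normal cov (rcons x a) ->
  exists x' c, x = rcons x' c /\ cov c a.
Proof.
case/lastP: x => [//|x c] nx; rewrite /normal; case: x nx => [|b x] nx /=.
  by rewrite andbT negbK; exists [::], c.
rewrite !rcons_path -/(rcons (b :: x) c) last_rcons negb_and negbK => /orP[|].
  by move: nx; rewrite /normal /= rcons_path => ->.
by exists (b :: x), c.
Qed.

(** * Resolution of overlaps by induction on the weight *)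

Section Step.
Variable m : nat.
Hypothesis IH : forall (x : seq letter) v u l, gt v u -> (0 < l <= lev u)%N ->
  (swt lwt x + lead_wt v u l < m)%N -> nf (mon x * (vrem v u)`_(lev v - lev u + l)) = 0.

(** Extends [IH] by linearity from words to left factors of bounded weight. *)
Lemma nf_vrem_lt (n : nat) (p : T) v u i : gt v u ->
    supp (fun s => swt lwt s <= n)%N p ->
    (lev v - lev u < i)%N -> (i <= lev v)%N ->
    (n + lead_wt v u (i - (lev v - lev u)) < m)%N ->
  nf (p * (vrem v u)`_i) = 0.
Proof.
move=> vu bp ki il lt_m; have uv := gt_lev vu.
have lb : (0 < i - (lev v - lev u) <= lev u)%N by lia.
have ei : (lev v - lev u + (i - (lev v - lev u)) = i)%N by lia.
elim/supp_ind: p / bp => [|c s p sa IHp]; first by rewrite mul0r linear0.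
rewrite mulrDl -scalerAl linearP /= IHp addr0 -ei IH ?scaler0 //.
by apply: leq_ltn_trans lt_m; rewrite leq_add2r.
Qed.

(** With [w] the vertex of [c], the word c e(v,|v|-|u|) e(u,l) is an overlap of two left-hand sides.
    One coefficient of [overlap_identity] expresses the critical product through terms of smaller
    weight. *)
Lemma nf_overlap x c v u l : gt (val c).1 v ->
    (val c).2 = (lev (val c).1 - lev v)%N -> gt v u -> (0 < l <= lev u)%N ->
    (swt lwt x + lwt c + lead_wt v u l <= m)%N ->
  nf (mon (rcons x c) * (vrem v u)`_(lev v - lev u + l)) = 0.
Proof.
move=> wv; set w := (val c).1 in wv *; set k1 := (lev w - lev v)%N => ec vu /andP[l0 llu] le_m.
have ltwv := gt_lev wv; have ltvu := gt_lev vu; have wu := gt_trans wv vu.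
set k := (lev v - lev u)%N.
(* [K] holds of the elements that normalize to 0 between [x] and any right factor. It is a right
   ideal, as [series_cancel] asks. *)
pose K (p : T) := forall z, nf (mon x * p * z) = 0.
have K0 : K 0 by move=> z; rewrite mulr0 mul0r linear0.
have KB p q : K p -> K q -> K (p - q).
  by move=> Kp Kq z; rewrite mulrBr mulrBl linearB /= Kp Kq subrr.
have KM p q : K p -> K (p * q) by move=> Kp z; rewrite mulrA -mulrA.
have KD p q : K p -> K q -> K (p + q).
  by move=> Kp Kq z; rewrite mulrDr mulrDl linearD /= Kp Kq addr0.
have bx n (p : T) : supp (fun s => swt lwt s <= n)%N p ->
    supp (fun s => swt lwt s <= swt lwt x + n)%N (mon x * p).
  move=> bp; apply: (suppM (C := eq x) _ _ bp) => [_ t <- tp|]; last exact: supp_mon.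
  by rewrite /swt big_cat leq_add2l.
have cE : lwt c = lweight (lev w) k1 by rewrite /lwt -/w ec.
(* Both remainders of E_w fall under [IH] by [lweight_merge]: [K1] merges the last two letters of
   the overlap, and [K3] the first two. *)
have K1 j : (j <= k1 + k + l)%N -> K (vrem w v)`_j.
  move=> lej z; have [jk|kj] := leqP j k1; first by rewrite vrem_small // mulr0 mul0r linear0.
  apply: nf_kill; apply: (@nf_vrem_lt (swt lwt x)) => //; try by lia.
    by apply: supp_mon.
  apply: leq_trans le_m; rewrite cE -addnA ltn_add2l /lead_wt ltn_add2l.
  apply: leq_ltn_trans (lweight_merge (ltnW ltvu) llu).
  by apply: lweight_leq; lia.
have K3 j : (j <= k1 + k + l)%N -> K (vrem w u)`_j.
  move=> lej z; have [jk|kj] := leqP j (lev w - lev u).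
    by rewrite vrem_small // mulr0 mul0r linear0.
  apply: nf_kill; apply: (@nf_vrem_lt (swt lwt x)) => //; try by lia.
    by apply: supp_mon.
  apply: leq_trans le_m; rewrite cE -addnA ltn_add2l /lead_wt addnA -/k1 -/k.
  have H1 : (lweight (lev u) (j - (lev w - lev u)) <= lweight (lev u) l)%N.
    by apply: lweight_leq => //; lia.
  apply: leq_ltn_trans (leq_add (leqnn _) H1) _; rewrite ltn_add2r.
  have -> : (lev w - lev u = k1 + k)%N by lia.
  by apply: lweight_merge; lia.
(* In total degree at most k1 + k + l, only the pair of degrees (k1, k+l) carries the overlap
   itself; all others have smaller weight. *)
have K2 h j : (h <= k1)%N -> (h + j <= k1 + (k + l))%N -> ((h == k1) && (j == k + l)%N = false) ->
    K ((vquo w v)`_h * (vrem v u)`_j).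
  move=> hk hj neq z; have [jk|kj] := leqP j k; first by rewrite vrem_small // !mulr0 mul0r linear0.
  have [jv|vj] := leqP j (lev v); last by rewrite vrem_big // !mulr0 mul0r linear0.
  rewrite mulrA; apply: nf_kill; apply: (@nf_vrem_lt (swt lwt x + lweight (lev w) h)) => //.
    by apply: bx; have [_] := vquo_bnd hk; apply: suppW => s [].
  apply: leq_trans le_m; rewrite cE -!addnA ltn_add2l /lead_wt !addnA -/k.
  rewrite ![(_ + lweight (lev v) _)%N]addnC -!addnA ltn_add2l.
  have [hk1|hk1] := eqVneq h k1.
    rewrite hk1 ltn_add2l; apply: lweight_ltn => //; move: neq; rewrite hk1 eqxx /=; lia.
  have lthk : (h < k1)%N by rewrite ltn_neqAle hk1.
  apply: (@leq_trans (lweight (lev w) k1 + lweight (lev u) l)) => //.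
  by apply: lweight_shift => //; lia.
have KF j : (j < k1 + k + l)%N -> K (vquo w v * vrem v u)`_j.
  move=> ltj; rewrite coefM; apply: (right_ideal_sum KB) => // h _.
  have [hk|kh] := leqP h k1; last by rewrite vquo_big ?mul0r.
  by apply: (K2) => //; lia.
(* The defect between dividing by E_u directly and through E_v. Up to degree k1 + k the right side
   of [overlap_identity] is in [K], and E_u can be cancelled; beyond that degree [S] vanishes. *)
pose S := vquo w u - vquo w v * vquo v u.
have KS j : K S`_j.
  have [jk|kj] := leqP j (k1 + k).
    apply: (series_cancel KB KM K0 (vser0 u) (m := (k1 + k)%N)) => // i lei.
    by rewrite overlap_identity coefB coefD; apply: (KB); [apply: (KD); [apply: (K1)|apply: (KF)]|apply: (K3)]; lia.
  rewrite coefB vquo_big ?sub0r; last by lia.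
  rewrite coefM big1 ?oppr0 // => h _.
  have [hk|kh] := leqP h k1; last by rewrite vquo_big ?mul0r.
  by rewrite [(vquo v u)`_ _]vquo_big ?mulr0 //; lia.
(* The identity is now solved for the product in the critical degree. *)
have : K (vquo w v * vrem v u)`_(k1 + (k + l)).
  have -> : vquo w v * vrem v u = S * vser u - vrem w v + vrem w u.
    by rewrite overlap_identity addrAC subrK addrC addKr.
  rewrite coefD coefB; apply: (KD); last by apply: (K3); lia.
  apply: (KB); last by apply: (K1); lia.
  by rewrite coefM; apply: (right_ideal_sum KB) => // h _; apply: (KM).
have k1lt : (k1 < (k1 + (k + l)).+1)%N by lia.
rewrite coefM (bigD1 (Ordinal k1lt)) //= addKn; set rest := \sum_(_ | _) _ => Ksum.
have Krest : K rest.
  apply: (right_ideal_sum KB) => // h hk.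
  have [lehk|kh] := leqP h k1; last by rewrite vquo_big ?mul0r.
  apply: (K2) => //; first by lia.
  by apply/negbTE; rewrite negb_and; apply/orP; left.
have := KB _ _ Ksum Krest 1; rewrite addrK mulr1.
(* The top quotient coefficient is the letter [c] plus words of smaller weight, which [IH] kills. *)
rewrite -[(vquo w v)`_k1](subrK (ltr w k1)) mulrDl mulrDr linearD /=.
have [B _] := vquo_bnd (leqnn k1).
rewrite [X in X + _](_ : _ = 0) ?add0r; last first.
  rewrite mulrA; apply: (@nf_vrem_lt (swt lwt x + (lwt c).-1)) => //; try by lia.
    by apply: bx; apply: suppW B => s []; rewrite cE.
  by rewrite addKn; apply: leq_trans le_m; rewrite ltn_add2r ltn_add2l cE.
by rewrite -ec ltr_letter mulrA -mon_cat cats1.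
Qed.
End Step.

(** Normalize [x] first. Then e(v,|v|-|u|) either extends it to a normal word, and the rule applies
    at once, or forms a reducible pair with its last letter, which is the overlap case. *)
Lemma nf_vrem x v u i : gt v u -> nf (mon x * (vrem v u)`_i) = 0.
Proof.
move=> vu; have uv := gt_lev vu.
have [ki|ik] := ltnP (lev v - lev u) i; last by rewrite vrem_small // mulr0 linear0.
have [il|li] := leqP i (lev v); last by rewrite vrem_big // mulr0 linear0.
have -> : i = (lev v - lev u + (i - (lev v - lev u)))%N by lia.
have: (0 < i - (lev v - lev u) <= lev u)%N by lia.
move: (i - _)%N => l {i ki il}; move: v u l x vu uv.
suff H m : forall v u l x, gt v u -> (lev u < lev v)%N -> (0 < l <= lev u)%N ->
    (swt lwt x + lead_wt v u l < m)%N -> nf (mon x * (vrem v u)`_(lev v - lev u + l)) = 0.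
  by move=> v u l x vu uv l0; apply: (H (swt lwt x + lead_wt v u l).+1).
elim: m => // m IHm v u l x vu uv lb lem; rewrite -nfK.
have: supp (fun s => normal cov s /\ bnd (sdeg ldeg x) (swt lwt x) s) (nf (mon x)).
  exact: nform_supp rule_lt x.
elim/supp_ind: (nf (mon x)) / => [|c s p [ns [_ ws]] IHp]; first by rewrite mul0r linear0.
rewrite mulrDl -scalerAl linearP /= IHp addr0 {p IHp}.
suff -> : nf (mon s * (vrem v u)`_(lev v - lev u + l)) = 0 by rewrite scaler0.
have {x lem ws} lem : (swt lwt s + lead_wt v u l <= m)%N.
  by rewrite -ltnS; apply: leq_ltn_trans lem; rewrite leq_add2r.
have la : (0 < lev v - lev u <= lev v)%N by lia.
pose a : letter := exist _ (v, (lev v - lev u)%N) la; pose b : letter := exist _ (u, l) lb.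
have ab : cov a b by rewrite /cov /= vu eqxx.
have [nsa|] := boolP (normal cov (rcons s a)).
  have := nform_last rule_lt nsa ab; rewrite opprD addNKr mulrN -/nf linearN /=.
  by move/eqP; rewrite oppr_eq0 => /eqP.
case/(normal_rcons_cov ns) => x [d [es /andP[/= dv /eqP ed]]]; rewrite es.
apply: (nf_overlap (m := m)) => //; last first.
  by move: lem; rewrite es /swt -cats1 big_cat big_seq1.
by move=> y v' u' l' vu' lb' ltm; apply: IHm => //; apply: gt_lev.
Qed.

End Poset.

(** * The basis of normal words *)

Lemma subrBB (M : zmodType) (x y z : M) : (x - y) - (x - z) = z - y.
Proof. by rewrite opprB addrC addrA subrK. Qed.

Section PolyIdeal.
Variables (R : nzRingType) (K : R -> Prop).
Hypothesis K0 : K 0.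
Hypothesis KB : forall x y, K x -> K y -> K (x - y).
Hypothesis KMr : forall x z, K x -> K (x * z).
Hypothesis KMl : forall z x, K x -> K (z * x).

Lemma idealN x : K x -> K (- x).
Proof. by move=> Kx; rewrite -sub0r; apply: KB. Qed.

Lemma idealD x y : K x -> K y -> K (x + y).
Proof. by move=> Kx Ky; rewrite -[y]opprK; apply/KB/idealN. Qed.

Definition coefs_in (f : {poly R}) := forall i, K f`_i.

Lemma coefs_inB (f g : {poly R}) : coefs_in f -> coefs_in g -> coefs_in (f - g).
Proof. by move=> Kf Kg i; rewrite coefB; apply: (KB). Qed.

Lemma coefs_inD (f g : {poly R}) : coefs_in f -> coefs_in g -> coefs_in (f + g).
Proof. by move=> Kf Kg i; rewrite coefD; apply: idealD. Qed.

Lemma coefs_inMl (g f : {poly R}) : coefs_in f -> coefs_in (g * f).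
Proof.
by move=> Kf i; rewrite coefM; apply: (right_ideal_sum KB) => // j _; apply: (KMl).
Qed.

Lemma coefs_inMr (f g : {poly R}) : coefs_in f -> coefs_in (f * g).
Proof.
by move=> Kf i; rewrite coefM; apply: (right_ideal_sum KB) => // j _; apply: (KMr).
Qed.

Lemma coefs_in_cancel (f g : {poly R}) : g`_0 = 1 -> coefs_in (f * g) -> coefs_in f.
Proof.
move=> g0 Kfg i.
by apply: (series_cancel KB KMr K0 g0 (m := i)) => // j _.
Qed.
End PolyIdeal.

Section GraphBasis.
Variables (F : fieldType) (G : layered_graph) (gt : rel (vertex G)) (bot : vertex G).
Local Notation lev := (@level G).
Local Notation letter := (letter lev).
Local Notation degree := (sdeg (@ldeg _ lev)).
Local Notation normal := (normal (@cov _ lev gt)).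

Fixpoint chain (v : vertex G) (p : seq (edge G)) (u : vertex G) : bool :=
  if p is e :: p' then (tail e == v) && chain (head e) p' u else v == u.

Lemma chain_cat v p w p' u : chain v p w -> chain w p' u -> chain v (p ++ p') u.
Proof.
elim: p v => [|e p IHp] v /=; first by move/eqP->.
by case/andP=> -> /IHp; apply.
Qed.

Lemma chain_size v p u : chain v p u -> lev v = (size p + lev u)%N.
Proof.
elim: p v => [|e p IHp] v /=; first by move/eqP->.
by case/andP=> /eqP<- /IHp; rewrite level_edge => ->.
Qed.

Variables (TE : free_alg F (edge G)) (TL : free_alg F letter).
Local Notation vser := (vser TL).
Local Notation vquo := (vquo TL).
Local Notation vrem := (vrem TL).
Local Notation nf := (nf gt (T := TL)).

Definition pser (p : seq (edge G)) : {poly TE} :=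
  \prod_(e <- p) (1 - (mon [:: e])%:P * 'X).

Lemma pser_cons e p : pser (e :: p) = pser p - (mon [:: e])%:P * (pser p * 'X).
Proof. by rewrite /pser big_cons mulrBl mul1r -mulrA commr_polyX. Qed.

Lemma coef_pser_cons e p i :
  (pser (e :: p))`_i = (pser p)`_i - (if i == 0%N then 0 else mon [:: e] * (pser p)`_i.-1).
Proof. by rewrite pser_cons coefB coefCM coefMX; case: eqP => //; rewrite mulr0. Qed.

Lemma pser0 p : (pser p)`_0 = 1.
Proof.
elim: p => [|e p IHp]; first by rewrite /pser big_nil coefC.
by rewrite coef_pser_cons subr0.
Qed.

Lemma pser_big p i : (size p < i)%N -> (pser p)`_i = 0.
Proof.
elim: p i => [|e p IHp] [|i] //= lti; first by rewrite /pser big_nil coefC.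
by rewrite coef_pser_cons /= !IHp ?mulr0 ?subr0 //; lia.
Qed.

Lemma pser_hom p i : supp (fun s => size s = i) (pser p)`_i.
Proof.
elim: p i => [|e p IHp] i.
  rewrite /pser big_nil coefC; case: eqP => [->|_]; last exact: supp0.
  by rewrite -mon_nil; apply: supp_mon.
rewrite coef_pser_cons; apply: suppB => //.
case: i => [|i] /=; first exact: supp0.
apply: (suppM (C := eq [:: e]) _ _ (IHp i)) => [_ t <- <- //|].
exact: supp_mon.
Qed.

Hypothesis gt_trans : transitive gt.
Hypothesis gt_lev : forall v u, gt v u -> (lev u < lev v)%N.
Hypothesis gt_edge : forall e, gt (tail e) (head e).
Hypothesis gt_chain : forall v u, gt v u -> exists p, chain v p u.
Hypothesis gt_bot : forall v, v = bot \/ gt v bot.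
Hypothesis lev_bot : lev bot = 0%N.

Variable I : TE -> Prop.
Hypothesis I0 : I 0.
Hypothesis IB : forall x y, I x -> I y -> I (x - y).
Hypothesis IMr : forall x z, I x -> I (x * z).
Hypothesis IMl : forall z x, I x -> I (z * x).
Hypothesis I_chain : forall v u p1 p2 i, chain v p1 u -> chain v p2 u ->
  I ((pser p1)`_i - (pser p2)`_i).

Lemma ex_bot_chain v : exists p, chain v p bot.
Proof. by case: (gt_bot v) => [->|/gt_chain//]; exists [::] => /=. Qed.

Definition bot_chain v : seq (edge G) := xchoose (ex_bot_chain v).

Lemma bot_chainP v : chain v (bot_chain v) bot.
Proof. exact: (xchooseP (ex_bot_chain v)). Qed.

(** For an edge e from v to u, the coefficient of s in E_v = (1 - e s) E_u gives e = e(u,1) -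
    e(v,1). *)
Definition of_edges : TE -> TL := wmap (fun e => ltr TL (head e) 1 - ltr TL (tail e) 1).
HB.instance Definition _ := GRing.LRMorphism.on of_edges.

(** An inverse of [of_edges] modulo the relations; by [I_chain] the choice of path does not matter
    modulo [I]. *)
Definition to_edges : TL -> TE :=
  wmap (fun a : letter => (pser (bot_chain (val a).1))`_(val a).2).
HB.instance Definition _ := GRing.LRMorphism.on to_edges.

(** The largest two-sided ideal on which [nf] vanishes, in the part of the ideal of relations among
    the letters. *)
Definition nf_null (p : TL) := forall x y, nf (x * p * y) = 0.

Lemma nf_null0 : nf_null 0.
Proof. by move=> x y; rewrite mulr0 mul0r linear0. Qed.

Lemma nf_nullB p q : nf_null p -> nf_null q -> nf_null (p - q).
Proof. by move=> Np Nq x y; rewrite mulrBr mulrBl linearB /= Np Nq subrr. Qed.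

Lemma nf_nullMr p q : nf_null p -> nf_null (p * q).
Proof. by move=> Np x y; rewrite mulrA -mulrA. Qed.

Lemma nf_nullMl q p : nf_null p -> nf_null (q * p).
Proof. by move=> Np x y; rewrite mulrA. Qed.

Lemma nf_null_eq p q : nf_null (p - q) -> nf p = nf q.
Proof.
by move/(_ 1 1); rewrite mul1r mulr1 linearB => /eqP; rewrite subr_eq0 => /eqP.
Qed.

Lemma nf_null_vrem v u : gt v u -> coefs_in nf_null (vrem v u).
Proof.
move=> vu i x y; apply: nf_kill => //; elim/free_ind: x => [|c s p IHp].
  by rewrite mul0r linear0.
by rewrite mulrDl -scalerAl linearP /= IHp nf_vrem // scaler0 addr0.
Qed.

Let NB := coefs_inB nf_nullB.
Let ND := coefs_inD nf_null0 nf_nullB.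
Let NMl := coefs_inMl nf_null0 nf_nullB nf_nullMl.

Lemma vquo_edge e :
  vquo (tail e) (head e) = 1 - (of_edges (mon [:: e]))%:P * 'X.
Proof.
have k1 : (lev (tail e) - lev (head e) = 1)%N by rewrite level_edge subSnn.
rewrite /of_edges wmap_mon big_seq1; apply/polyP => -[|[|i]].
- by rewrite vquoE // big_ord0 ltr0 subr0 coefB coefMX coefC subr0.
- rewrite vquoE ?k1 // big_ord1 vquoE // big_ord0 ltr0 subr0 mul1r subn0.
  by rewrite coefB coefMX !coefC sub0r opprB.
- by rewrite vquo_big ?k1 // coefB coefMX !coefC subr0.
Qed.

(** Each edge is a division with quotient 1 - e s and null remainder; composition along the chain
    telescopes. *)
Lemma vser_chain v p u : chain v p u ->
  coefs_in nf_null (vser v - map_poly of_edges (pser p) * vser u).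
Proof.
elim: p v => [|e p IHp] v /=.
  by move/eqP->; rewrite /pser big_nil rmorph1 mul1r subrr => i; rewrite coef0; apply: nf_null0.
case/andP=> /eqP<- {v} /IHp {}IHp.
have -> : vser (tail e) - map_poly of_edges (pser (e :: p)) * vser u =
  vrem (tail e) (head e) + vquo (tail e) (head e) *
    (vser (head e) - map_poly of_edges (pser p) * vser u).
  rewrite mulrBr addrA /vrem subrK; congr (_ - _).
  by rewrite /pser big_cons rmorphM vquo_edge rmorphB rmorph1 rmorphM /= map_polyC map_polyX mulrA.
by apply: ND; [apply: nf_null_vrem|apply: NMl].
Qed.

(** Both chains divide E_v by E_u modulo null elements, and E_u can be cancelled. *)
Lemma of_edges_chain v u p1 p2 i : chain v p1 u -> chain v p2 u ->
  nf_null (of_edges ((pser p1)`_i - (pser p2)`_i)).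
Proof.
move=> c1 c2; rewrite -coefB -coef_map; move: i.
apply: (coefs_in_cancel nf_null0 nf_nullB nf_nullMr (vser0 TL u)).
have -> : map_poly of_edges (pser p1 - pser p2) * vser u =
    (vser v - map_poly of_edges (pser p2) * vser u) -
    (vser v - map_poly of_edges (pser p1) * vser u).
  by rewrite rmorphB mulrBl subrBB.
by apply: NB; apply: vser_chain.
Qed.

Lemma nf_null_of_edges_ideal : two_sided_ideal (fun x => nf_null (of_edges x)).
Proof.
split=> [|y z Ny Nz|a y Ny]; first by rewrite rmorph0; apply: nf_null0.
  by rewrite rmorphB; apply: nf_nullB.
by rewrite !rmorphM; split; [apply: nf_nullMl|apply: nf_nullMr].
Qed.

Lemma to_edges_ltr v i : to_edges (ltr TL v i) = (pser (bot_chain v))`_i.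
Proof.
rewrite /ltr; case: insubP => [a _ eva|] /=.
  by rewrite /to_edges wmap_mon big_seq1 eva.
have := chain_size (bot_chainP v); rewrite lev_bot addn0 => -> /=.
case: i => [|i] /=; first by rewrite rmorph1 pser0.
by rewrite rmorph0 -leqNgt => lei; rewrite pser_big.
Qed.

Lemma map_vser v : map_poly to_edges (vser v) = pser (bot_chain v).
Proof. by apply/polyP => i; rewrite coef_map coef_vser /= to_edges_ltr. Qed.

(** A path from [v] to [u] divides E_v by E_u without remainder modulo [I]. Quotients being unique
    up to degree |v|-|u|, it agrees with the image of [vquo], so the formal remainder maps into
    [I]. *)
Lemma I_vrem v u i : gt v u -> I (to_edges (vrem v u)`_i).
Proof.
move=> vu; have [p vp] := gt_chain vu.
pose Q := map_poly to_edges (vquo v u).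
have eqrem : map_poly to_edges (vrem v u) = pser (bot_chain v) - Q * pser (bot_chain u).
  by rewrite rmorphB rmorphM /= !map_vser.
have Ip : coefs_in I (pser (bot_chain v) - pser p * pser (bot_chain u)).
  move=> j; rewrite /pser -big_cat coefB.
  by apply: I_chain (bot_chainP v) (chain_cat vp (bot_chainP u)).
have IS : coefs_in I (pser p - Q).
  have sp : size p = (lev v - lev u)%N by rewrite (chain_size vp) addnK.
  move=> j; have [jk|kj] := leqP j (lev v - lev u); last first.
    by rewrite coefB pser_big ?sp // coef_map /= vquo_big // rmorph0 subr0.
  apply: (series_cancel IB IMr I0 (pser0 (bot_chain u)) (m := (lev v - lev u)%N)) => // h hk.
  have -> : (pser p - Q) * pser (bot_chain u) = map_poly to_edges (vrem v u) -
      (pser (bot_chain v) - pser p * pser (bot_chain u)).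
    by rewrite eqrem mulrBl subrBB.
  by rewrite coefB coef_map /= vrem_small // rmorph0; apply: (IB).
rewrite -[to_edges _]/(to_edges (vrem v u)`_i) -coef_map; move: i.
have -> : map_poly to_edges (vrem v u) =
    (pser (bot_chain v) - pser p * pser (bot_chain u)) + (pser p - Q) * pser (bot_chain u).
  by rewrite eqrem mulrBl addrA subrK.
by apply: (coefs_inD I0 IB) => //; apply: coefs_inMr.
Qed.

Lemma I_red s : I (to_edges (red (cov gt) (rule TL) s - mon s)).
Proof.
elim: s => [|a [|b s] IHs]; try by rewrite /= subrr rmorph0.
rewrite red_cons; case: ifP => [/andP[ab _]|_].
  rewrite -[a :: b :: s]/([:: a; b] ++ s) mon_cat -mulrBl rmorphM; apply: (IMr).
  by rewrite /rule addrC addKr; apply: I_vrem.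
by rewrite -[a :: b :: s]/([:: a] ++ b :: s) mon_cat -mulrBr rmorphM; apply: (IMl).
Qed.

Lemma I_nf p : I (to_edges (nf p - p)).
Proof.
have ID := idealD I0 IB.
have IZ c x : I x -> I (c *: x) by move=> Ix; rewrite -[x]mul1r scalerAl; apply: (IMl).
elim/free_ind: p => [|c s p IHp]; first by rewrite linear0 subrr rmorph0.
rewrite linearP /= opprD addrACA -scalerBr linearP /=; apply: (ID) => //; apply: (IZ).
elim/(nform_ind (rule_lt (T := TL) gt_lev)): s {IHp} => s.
  by move=> ns; rewrite /nf nform_normal // subrr rmorph0.
move=> nns IHs; rewrite /nf (nform_red (rule_lt (T := TL) gt_lev)) // -/nf.
rewrite -(subrK (red (cov gt) (rule TL) s) (nf _)) -addrA rmorphD; apply: (ID); last exact: I_red.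
elim/supp_ind: (red _ _ _) / IHs => [|d t q It IHq]; first by rewrite linear0 subrr rmorph0.
by rewrite linearP /= opprD addrACA -scalerBr linearP /=; apply: (ID) => //; apply: (IZ).
Qed.

(** It suffices to treat one edge: prolong it to the bottom and compare with the chosen path from
    its tail in degree 1. *)
Lemma I_of_edges x : I (to_edges (of_edges x) - x).
Proof.
have ID := idealD I0 IB.
have IZ c y : I y -> I (c *: y) by move=> Iy; rewrite -[y]mul1r scalerAl; apply: (IMl).
elim/free_ind: x => [|c s x IHx]; first by rewrite !rmorph0 subrr.
rewrite [of_edges _]linearP [to_edges _]linearP /= opprD addrACA -scalerBr.
apply: (ID) => //; apply: (IZ).
elim: s => [|e s IHs]; first by rewrite mon_nil !rmorph1 subrr.
rewrite -[e :: s]/([:: e] ++ s) mon_cat !rmorphM /=.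
set a := to_edges _; set b := to_edges _ in IHs *.
have -> : a * b - mon [:: e] * mon s = (a - mon [:: e]) * b + mon [:: e] * (b - mon s).
  by rewrite mulrBl mulrBr addrA subrK.
apply: (ID); last exact: (IMl); apply: (IMr).
rewrite /a /of_edges wmap_mon big_seq1 rmorphB /= !to_edges_ltr.
have ch : chain (tail e) (e :: bot_chain (head e)) bot by rewrite /= eqxx bot_chainP.
have := I_chain 1 ch (bot_chainP (tail e)).
by rewrite coef_pser_cons /= pser0 mulr1 addrAC.
Qed.

(** On each letter [of_edges] undoes [to_edges] modulo null elements, by [vser_chain] down to the
    bottom, where the series is 1. A normal word is its own normal form. *)
Lemma nf_to_edges s : normal s -> nf (of_edges (to_edges (mon s))) = mon s.
Proof.
move=> ns; rewrite -[RHS](nform_normal (lwt (lev := lev)) (rule TL) ns).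
apply: nf_null_eq; elim: s {ns} => [|a s IHs].
  by rewrite mon_nil !rmorph1 subrr; apply: nf_null0.
rewrite -[a :: s]/([:: a] ++ s) mon_cat !rmorphM /=.
set x := of_edges _; set y := of_edges _ in IHs *.
have -> : x * y - mon [:: a] * mon s = (x - mon [:: a]) * y + mon [:: a] * (y - mon s).
  by rewrite mulrBl mulrBr addrA subrK.
apply: (idealD nf_null0 nf_nullB); last exact: nf_nullMl; apply: nf_nullMr.
rewrite /x -(ltr_letter TL a) to_edges_ltr.
have vb : vser bot = 1.
  by apply/polyP => -[|i]; rewrite coef_vser coefC ?ltr0 // ltr_big // lev_bot.
have := vser_chain (bot_chainP (val a).1) (val a).2.
rewrite vb mulr1 coefB coef_map coef_vser /= => /(idealN nf_null0 nf_nullB).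
by rewrite opprB.
Qed.

Lemma of_edges_hom s : supp (fun t => degree t = size s) (of_edges (mon s)).
Proof.
rewrite /of_edges wmap_mon; elim: s => [|e s IHs].
  by rewrite big_nil -mon_nil; apply: supp_mon; rewrite /sdeg big_nil.
rewrite big_cons; apply: (suppM (C := fun t => degree t = 1%N) _ _ IHs) => [t u dt du|].
  by rewrite /sdeg big_cat -!/(sdeg _ _) dt du.
by apply: suppB; apply: suppW (@ltr_bnd _ _ _ _ _ _ ) => t [].
Qed.

Lemma to_edges_hom s : supp (fun t => size t = degree s) (to_edges (mon s)).
Proof.
rewrite /to_edges wmap_mon; elim: s => [|a s IHs].
  by rewrite big_nil -mon_nil; apply: supp_mon; rewrite /sdeg big_nil.
rewrite big_cons; apply: (suppM _ (@pser_hom _ _) IHs) => t u dt du.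
by rewrite size_cat dt du /sdeg big_cons.
Qed.

Section Degree.
Variables (d : nat) (ws : seq (seq letter)).
Hypothesis ws_uniq : uniq ws.
Hypothesis mem_ws : forall s, (s \in ws) = normal s && (degree s == d).

(** The coefficients are those of the normal form of [of_edges x]; [I_nf] and [I_of_edges] bring it
    back to [x] modulo [I]. *)
Lemma normal_words_span x : supp (fun s => size s = d) x ->
  exists c : seq letter -> F, I (x - \sum_(s <- ws) c s *: to_edges (mon s)).
Proof.
move=> xd; pose y := nf (of_edges x); exists (fun s => coef s y).
have yE : y = \sum_(s <- ws) coef s y *: mon s.
  have: supp (fun s => s \in ws) y.
    rewrite /y; elim/supp_ind: x / xd {y} => [|c s x sd IHx]; first by rewrite !linear0; apply: supp0.
    rewrite !linearP /=; apply: suppP IHx.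
    apply: (supp_lin _ (@of_edges_hom s)) => t dt.
    have -> : nform_fuel (cov gt) (rule TL) (swt (lwt (lev := lev)) t) t = nf (mon t).
      by rewrite /nf /nform lin_mon.
    move=> u hu; have [nu [du _]] := nform_supp (rule_lt (T := TL) gt_lev) hu.
    by rewrite mem_ws nu du dt sd eqxx.
  exact: supp_expand.
have -> : \sum_(s <- ws) coef s y *: to_edges (mon s) = to_edges y.
  by rewrite {2}yE linear_sum; apply: eq_bigr => s _; rewrite linearZ.
have := idealD I0 IB (I_nf (of_edges x)) (I_of_edges x).
rewrite rmorphB /= addrA subrK => /(idealN I0 IB).
by rewrite opprB.
Qed.

Hypothesis I_of : forall x, I x -> nf_null (of_edges x).

(** Under [of_edges] and [nf] the combination becomes the same combination of the normal words
    themselves, which are distinct monomials. *)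
Lemma normal_words_free (c : seq letter -> F) :
  I (\sum_(s <- ws) c s *: to_edges (mon s)) -> forall s, s \in ws -> c s = 0.
Proof.
move=> Ic s sw; have := coef_combination TL c s ws_uniq; rewrite sw => <-.
suff -> : \sum_(t <- ws) c t *: mon t = 0 :> TL by rewrite linear0.
have := nf_null_eq (p := of_edges (\sum_(s <- ws) c s *: to_edges (mon s))) (q := 0).
rewrite subr0 linear0 => /(_ (I_of Ic)) H.
rewrite -[RHS]H [of_edges _]linear_sum [nf _]linear_sum; apply: eq_big_seq => t.
by rewrite mem_ws => /andP[nt _]; rewrite !linearZ /= nf_to_edges.
Qed.

Lemma normal_words_hom s : s \in ws -> supp (fun t => size t = d) (to_edges (mon s)).
Proof.
by rewrite mem_ws => /andP[_ /eqP<-]; apply: to_edges_hom.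
Qed.

End Degree.
End GraphBasis.

(** * Dimension of a graded piece of a quotient algebra *)

Section QuotientDimension.
Local Open Scope quotient_scope.
Variables (F : fieldType) (T : lalgType F) (S H : T -> Prop) (m : nat) (f : 'I_m -> T).
Hypothesis f_hom : forall j, H (f j).
Hypothesis f_span : forall x, H x ->
  exists c : 'I_m -> F, ideal_generated S (x - \sum_(j < m) c j *: f j).
Hypothesis f_free : forall c : 'I_m -> F,
  ideal_generated S (\sum_(j < m) c j *: f j) -> forall j, c j = 0.

Lemma pi_combination (c : 'I_m -> F) :
  \pi_(alg_quot S) (\sum_(j < m) c j *: f j) =
  \sum_(j < m) c j *: (\pi_(alg_quot S) (f j) : alg_quot S).
Proof.
elim/big_ind2: _ => [|x x' y y' <- <-|j _]; last exact: pi_aqZ; last exact: pi_aqD.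
have := pi_aqD S 0 0; rewrite addr0 => /esym/eqP.
by rewrite -[X in _ == X]addr0 => /eqP/addrI.
Qed.

Lemma alg_quot_has_dim :
  has_dim (fun a : alg_quot S => exists2 x : T, H x & a = \pi_(alg_quot S) x) m.
Proof.
exists (fun j => \pi_(alg_quot S) (f j)); split=> [j|a [x Hx ->{a}]]; first by exists (f j).
have [c cx] := f_span Hx; exists [ffun j => c j]; split=> [|c'].
  under eq_bigr do rewrite ffunE; rewrite -pi_combination.
  exact/aq_eqP/ideal_predP.
rewrite -pi_combination => /aq_eqP/ideal_predP xc'; apply/ffunP => j; rewrite ffunE.
have [_ IB _] := ideal_generatedP S.
apply/eqP; rewrite -subr_eq0; apply/eqP; apply: (f_free (c := fun j => c j - c' j)).
have := IB _ _ xc' cx; rewrite subrBB; congr (ideal_generated S _).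
by rewrite -sumrB; apply: eq_bigr => i _; rewrite scalerBl.
Qed.
End QuotientDimension.

(** * The monoid algebra as a free algebra *)

Section MonoidAlgebra.
Variables (F : fieldType) (A : choiceType).
Local Notation T := {malg F[{fmonom A}]}.

Lemma malg_mon_nil : << FMonom [::] >> = 1 :> T.
Proof. by rewrite -fmoneE. Qed.

Lemma malg_mon_cat (s t : seq A) : << FMonom (s ++ t) >> = << FMonom s >> * << FMonom t >> :> T.
Proof.
by rewrite malgM_def fgmulUU mulr1; congr << _ >>; exact/esym/(fmmulE (FMonom s) (FMonom t)).
Qed.

Lemma malg_scalerAr (c : F) (p q : T) : c *: (p * q) = p * (c *: q).
Proof.
apply/malgP=> k; rewrite [LHS]mcoeffZ [X in _ * X]mcoeffMl.
rewrite [RHS](mcoeffMlw k (fsubset_refl _) (msuppZ_le c q)).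
rewrite mulr_sumr; apply: eq_bigr => k1 _.
rewrite mulr_sumr; apply: eq_bigr => k2 _.
by rewrite [X in _ = (_ * X) *+ _]mcoeffZ mulrnAr mulrCA.
Qed.

Lemma malg_coef_is_linear (s : seq A) : scalar (fun p : T => p@_(FMonom s)).
Proof. by move=> c p q; rewrite mcoeffD mcoeffZ. Qed.

Lemma malg_coef_mon (s t : seq A) : (<< FMonom t >> : T)@_(FMonom s) = (s == t)%:R.
Proof. by rewrite mcoeffU1 eq_sym. Qed.

Lemma malg_monoms_uniq (p : T) : uniq [seq val k | k <- msupp p].
Proof. by rewrite map_inj_uniq ?fset_uniq //; apply: val_inj. Qed.

Lemma malg_mon_expand (p : T) :
  p = \sum_(s <- [seq val k | k <- msupp p]) p@_(FMonom s) *: << FMonom s >>.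
Proof.
rewrite big_map {1}[p]monalgE; apply: eq_bigr => k _.
by apply/malgP=> l; rewrite mcoeffZ !mcoeffU fmK mulr_natr.
Qed.

Definition malg_free : free_alg F A :=
  FreeAlg malg_mon_nil malg_mon_cat malg_scalerAr malg_coef_is_linear malg_coef_mon
    malg_monoms_uniq malg_mon_expand.
End MonoidAlgebra.

(* The same free algebra, over the ring structure carried by free_algebra. *)
Definition graph_free (F : fieldType) (G : layered_graph) : free_alg F (edge G) :=
  @FreeAlg F (edge G) (free_algebra F G) _ _ _ (@malg_mon_nil F (edge G))
    (@malg_mon_cat F (edge G)) (@malg_scalerAr F (edge G)) (@malg_coef_is_linear F (edge G))
    (@malg_coef_mon F (edge G)) (@malg_monoms_uniq F (edge G)) (@malg_mon_expand F (edge G)).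

(** Passage from tau to s = 1/tau. Both products obey the same recursion on the factors; vanishing
    beyond the top degree settles the extreme indices. *)
Lemma coef_prod_reverse (R : nzRingType) (s : seq R) j : (j <= size s)%N ->
  (\prod_(x <- s) ('X - x%:P))`_(size s - j) = (\prod_(x <- s) (1 - x%:P * 'X))`_j.
Proof.
have big1 (r : seq R) i : (size r < i)%N -> (\prod_(x <- r) ('X - x%:P))`_i = 0.
  elim: r i => [|x r IHr] [|i] //= ri; first by rewrite big_nil coefC.
  by rewrite big_cons mulrBl coefB coefXM coefCM /= !IHr ?mulr0 ?subr0 //; lia.
have consE x (r : seq R) i : (\prod_(y <- x :: r) (1 - y%:P * 'X))`_i =
    (\prod_(y <- r) (1 - y%:P * 'X))`_i -
    (if i == 0%N then 0 else x * (\prod_(y <- r) (1 - y%:P * 'X))`_i.-1).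
  rewrite big_cons mulrBl mul1r -mulrA -commr_polyX coefB coefCM coefMX.
  by case: eqP; rewrite ?mulr0.
have big2 (r : seq R) i : (size r < i)%N -> (\prod_(x <- r) (1 - x%:P * 'X))`_i = 0.
  elim: r i => [|x r IHr] [|i] //= ri; first by rewrite big_nil coefC.
  by rewrite consE /= !IHr ?mulr0 ?subr0 //; lia.
elim: s j => [|x s IHs] j /=; first by rewrite leqn0 => /eqP->; rewrite !big_nil.
move=> js; rewrite consE big_cons mulrBl coefB coefXM coefCM.
case: j js => [|j] js /=; first by have := IHs 0%N (leq0n _); rewrite !subn0 (big1 s (size s).+1) // mulr0 !subr0.
rewrite subSS IHs //; congr (_ - _).
move: js; rewrite ltnS leq_eqVlt => /predU1P[->|js]; first by rewrite subnn big2.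
by rewrite subn_eq0 leqNgt js /= -IHs //; congr (_`_ _); lia.
Qed.

(** * Graded pieces of the graph algebra *)

Section GraphDimension.
Variables (F : fieldType) (G : layered_graph) (gt : rel (vertex G)) (bot : vertex G).
Local Notation lev := (@level G).
Local Notation TE := (graph_free F G).
Variable TL : free_alg F (letter lev).

Hypothesis gt_trans : transitive gt.
Hypothesis gt_lev : forall v u, gt v u -> (lev u < lev v)%N.
Hypothesis gt_edge : forall e, gt (tail e) (head e).
Hypothesis gt_chain : forall v u, gt v u -> exists p, chain v p u.
Hypothesis gt_bot : forall v, v = bot \/ gt v bot.
Hypothesis lev_bot : lev bot = 0%N.

Lemma path_coef_pser (p : seq (edge G)) j : (j <= size p)%N ->
  path_coef F p j = (pser TE p)`_j.
Proof.
move=> jp; have := @coef_prod_reverse (free_algebra F G) (map (gen F (G := G)) p) j.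
rewrite size_map => /(_ jp); rewrite !big_map => H.
transitivity ((\prod_(e <- p) (1 - (gen F e)%:P * 'X))`_j); first exact: H.
rewrite /pser.
have -> : gen F (G := G) = (fun e => @mon F (edge G) TE [:: e]).
  by apply/funext => e; rewrite /gen fmuE.
reflexivity.
Qed.

Lemma is_path_chain (e : edge G) p : is_path e p = chain (tail e) (e :: p) (head (last e p)).
Proof.
rewrite /= eqxx /is_path /=; elim: p e => [|e' p IHp] e /=; first by rewrite eqxx.
by rewrite IHp.
Qed.

Local Notation I := (@ideal_generated F TE (@relator F G)).

(** Outside 1 <= i <= length the two coefficients are both 1 or both 0; inside, their difference is
    a relator. *)
Lemma ideal_chain v u p1 p2 i : chain v p1 u -> chain v p2 u ->
  I ((pser TE p1)`_i - (pser TE p2)`_i).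
Proof.
move=> c1 c2; have [I0 _ _] := @ideal_generatedP F TE (@relator F G).
have sz : size p1 = size p2 by apply/(@addIn (lev u)); rewrite -(chain_size c1) -(chain_size c2).
case: p1 p2 sz c1 c2 => [|e1 p1] [|e2 p2] // sz; first by rewrite subrr.
move=> c1 c2; have [i0|i0] := posnP i; first by rewrite i0 !pser0 subrr.
have [isz|szi] := leqP i (size (e1 :: p1)); last first.
  by rewrite !pser_big ?subrr // -sz.
have /andP[/eqP t1 _] := c1; have /andP[/eqP t2 _] := c2.
have chain_last (e : edge G) p w : chain (tail e) (e :: p) w -> head (last e p) = w.
  rewrite /= eqxx /=; elim: p e => [|e' p IHp] e /=; first by move/eqP.
  by case/andP=> _ /IHp.
move: c1 c2; rewrite -{1}t1 -{1}t2 => c1 c2.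
have h1 := chain_last _ _ _ c1; have h2 := chain_last _ _ _ c2.
move=> J _; apply; exists e1, e2, p1, p2, i; split.
- by rewrite is_path_chain h1.
- by rewrite is_path_chain h2.
- by rewrite t1 t2.
- by rewrite h1 h2.
split; first by rewrite i0.
by rewrite (path_coef_pser isz) path_coef_pser // -sz.
Qed.

(** The preimage of the null elements is a two-sided ideal, so relators are enough. *)
Lemma ideal_nf_null x : I x -> nf_null gt (of_edges TL x).
Proof.
move=> Ix; have := Ix _ (nf_null_of_edges_ideal gt TE TL); apply => {x Ix}.
move=> _ [e1 [e2 [p1 [p2 [k [path1 path2 et eh [/andP[_ k1] ->]]]]]]].
have c1 : chain (tail e1) (e1 :: p1) (head (last e1 p1)) by rewrite -is_path_chain.
have c2 : chain (tail e1) (e2 :: p2) (head (last e1 p1)).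
  by rewrite et eh -is_path_chain.
have sz : size (e1 :: p1) = size (e2 :: p2).
  by apply/(@addIn (lev (head (last e1 p1)))); rewrite -(chain_size c1) -(chain_size c2).
rewrite !path_coef_pser // -?sz //.
exact: (of_edges_chain TE gt_trans gt_lev gt_edge k c1 c2).
Qed.

Lemma graph_alg_has_dim (d : nat) (ws : seq (seq (letter lev))) : uniq ws ->
    (forall s, (s \in ws) = normal (@cov _ lev gt) s && (sdeg (@ldeg _ lev) s == d)) ->
  has_dim (@graph_alg_homogeneous F G d) (size ws).
Proof.
move=> uws mws; have [I0 IB IM] := @ideal_generatedP F TE (@relator F G).
have IMl z x : I x -> I (z * x) by move=> /(IM z) [].
have IMr x z : I x -> I (x * z) by move=> /(IM z) [].
pose f s := to_edges TE gt_chain gt_bot (mon s : TL).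
pose g (j : 'I_(size ws)) := f (nth [::] ws j).
have sumE (c : seq (letter lev) -> F) :
    \sum_(j < size ws) c (nth [::] ws j) *: g j = \sum_(s <- ws) c s *: f s.
  by rewrite (big_nth [::]) big_mkord.
have homE x : free_homogeneous d x <-> supp (fun s => size s = d) (x : TE).
  by split=> Hx; [move=> s /Hx|case=> s /Hx].
apply: (@alg_quot_has_dim F TE (@relator F G) (free_homogeneous d) _ g).
- move=> j; apply/homE.
  by apply: normal_words_hom mws _ _; apply: mem_nth.
- move=> x /homE xd.
  have [c Hc] := normal_words_span TL gt_lev gt_chain gt_bot lev_bot I0 IB IMr IMl ideal_chain uws mws xd.
  by exists (fun j => c (nth [::] ws j)); rewrite sumE.
(* The coefficients are indexed by positions; [c'] reindexes them by words, with 0 off the list. *)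
move=> c Ic j; pose c' s := if insub (index s ws) is Some j then c j else 0.
have c'E (i : 'I_(size ws)) : c' (nth [::] ws i) = c i.
  by rewrite /c' index_uniq // insubT //= => lti; congr c; apply: val_inj.
rewrite -c'E; apply: (normal_words_free gt_trans gt_lev gt_edge lev_bot uws mws ideal_nf_null).
  by rewrite -sumE; under eq_bigr do rewrite c'E; exact: Ic.
exact: mem_nth.
Qed.
End GraphDimension.

(** * Counting subspaces *)

Section QBinomial.
Variable q : nat.
Hypothesis q1 : (1 < q)%N.
Local Notation Q := (q%:R : rat).

Lemma qint_neq0 i : Q ^+ i.+1 - 1 != 0.
Proof.
rewrite subr_eq0 -natrX -[1]/(1%:R) eqr_nat gtn_eqF // -(exp1n i.+1).
by rewrite ltn_exp2r.
Qed.

Lemma qbinom0 n : qbinom q n 0 = 1.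
Proof. by rewrite /qbinom big_ord0. Qed.

Lemma qbinom_gt n m : (n < m)%N -> qbinom q n m = 0.
Proof. by move=> nm; rewrite /qbinom (bigD1 (Ordinal nm)) //= subnn expr0 subrr !mul0r. Qed.

Lemma qbinomSr n m : qbinom q n m.+1 = qbinom q n m * ((Q ^+ (n - m) - 1) / (Q ^+ m.+1 - 1)).
Proof. by rewrite /qbinom big_ord_recr. Qed.

Lemma qbinomSS n m :
  qbinom q n.+1 m.+1 = qbinom q n m * ((Q ^+ n.+1 - 1) / (Q ^+ m.+1 - 1)).
Proof.
rewrite /qbinom !prodf_div big_ord_recl /= subn0.
under eq_bigr => i _ do rewrite /bump /= add1n subSS.
rewrite [in LHS]big_ord_recr /= invfM; ring.
Qed.

Lemma qbinom_pascal n m :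
  qbinom q n.+1 m.+1 = Q ^+ m.+1 * qbinom q n m.+1 + qbinom q n m.
Proof.
rewrite qbinomSS qbinomSr; have [mn|nm] := leqP m n; last by rewrite (qbinom_gt nm) !mul0r mulr0 addr0.
have -> : Q ^+ n.+1 = Q ^+ m.+1 * Q ^+ (n - m) by rewrite -exprD addSn subnKC.
by field; apply: qint_neq0.
Qed.

Lemma qbinom_sym n m : (m <= n)%N -> qbinom q n (n - m) = qbinom q n m.
Proof.
elim: n m => [|n IHn] [|m] //.
  move=> _; rewrite subn0 qbinom0; elim: n {IHn} => [|n IHn]; rewrite qbinomSS ?qbinom0 ?IHn.
    by rewrite mul1r divff // qint_neq0.
  by rewrite mul1r divff // qint_neq0.
rewrite ltnS leq_eqVlt => /predU1P[->|mn].
  rewrite subnn qbinom0; elim: n {IHn} => [|n IHn]; rewrite qbinomSS ?qbinom0 -?IHn.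
    by rewrite mul1r divff // qint_neq0.
  by rewrite mul1r divff // qint_neq0.
rewrite subSS -[(n - m)%N]prednK ?subn_gt0 // !qbinom_pascal prednK ?subn_gt0 //.
have -> : (n - m).-1 = (n - m.+1)%N by lia.
rewrite (IHn m.+1 mn) (IHn m (ltnW mn)) qbinomSr.
have -> : (n - m)%N = (n - m.+1).+1 by lia.
by field; apply: qint_neq0.
Qed.

(** The q-Pochhammer symbol (t; q)_j. *)
Definition qpoch j : {poly rat} := \prod_(i < j) (1 - (q ^ i)%:R%:P * 'X).

(** After Pascal's rule and a shift of index, the two terms with [qbinom q d i] add up to the [i]-th
    summand for [d], since q^i t + (1 - q^i t) = 1. *)
Lemma qbinom_qpoch d : \sum_(j < d.+1) (qbinom q d j)%:P * ('X^(d - j) * qpoch j) = 1.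
Proof.
elim: d => [|d IHd]; first by rewrite big_ord1 qbinom0 /qpoch big_ord0 !mulr1.
rewrite big_ord_recl subn0 qbinom0 [qpoch 0]big_ord0 mulr1 mul1r.
under eq_bigr => i _ do rewrite lift0 qbinom_pascal subSS polyCD mulrDl.
rewrite big_split /= addrA.
have -> : 'X^(d.+1) + \sum_(i < d.+1) (Q ^+ i.+1 * qbinom q d i.+1)%:P * ('X^(d - i) * qpoch i.+1) =
    \sum_(i < d.+1) (Q ^+ i * qbinom q d i)%:P * ('X^(d.+1 - i) * qpoch i).
  rewrite [RHS]big_ord_recl [LHS]addrC [in LHS]big_ord_recr /= addrC.
  rewrite qbinom_gt // mulr0 mul0r addr0 subn0 qbinom0 [qpoch 0]big_ord0 !mulr1 mul1r.
  congr (_ + _); apply: eq_bigr => i _.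
rewrite -[RHS]IHd -big_split /=; apply: eq_bigr => i _.
rewrite /qpoch big_ord_recr /= natrX subSn -1?ltnS // exprS polyCM; ring.
Qed.

End QBinomial.

Section SubspaceCount.
Variables (K : finFieldType) (n : nat).
Local Notation vT := 'rV[K]_n.
Local Notation q := #|K|.
Implicit Types (U V W : {vspace vT}) (s t : seq vT).

(** Every subspace is the span of the finite set of its own vectors, so the spans of all subsets
    exhaust them. *)
Definition subspaces : seq {vspace vT} :=
  undup [seq <<enum (A : {set vT})>>%VS | A <- enum {: {set vT}}].

Lemma subspaces_uniq : uniq subspaces.
Proof. exact: undup_uniq. Qed.

Lemma mem_subspaces V : V \in subspaces.
Proof.
rewrite mem_undup; apply/mapP; exists [set x | x \in V]; first by rewrite mem_enum.
apply/eqP; rewrite eqEsubv; apply/andP; split.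
  by apply/subvP => x xV; apply: memv_span; rewrite mem_enum inE.
by apply/span_subvP => x; rewrite mem_enum inE.
Qed.

(** Linearly independent [m]-tuples in [V], to be counted twice: by successive choice of vectors,
    and by span. *)
Fixpoint free_seqs V m : seq (seq vT) :=
  if m is m'.+1 then
    flatten [seq [seq x :: t | x <- enum {: vT} & (x \in V) && (x \notin <<t>>%VS)]
                 | t <- free_seqs V m']
  else [:: [::]].

Lemma mem_free_seqs V m t :
  (t \in free_seqs V m) = [&& size t == m, free t & (<<t>> <= V)%VS].
Proof.
elim: m t => [|m IHm] [|x t]; rewrite ?inE //=.
- by rewrite nil_free span_nil sub0v.
- by apply/flattenP => -[_ /mapP[s _ ->] /mapP[x]].
rewrite free_cons span_cons subv_add -memvE eqSS.
apply/flattenP/idP => [[_ /mapP[s + ->] /mapP[y + [-> ->]]]|].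
  by rewrite mem_filter IHm => /and3P[-> -> ->] /andP[/andP[-> ->]].
case/and3P=> st /andP[xt ft] /andP[xV tV].
eexists; first by apply/mapP; exists t; rewrite ?IHm ?st ?ft ?tV.
by apply/mapP; exists x => //; rewrite mem_filter xV xt mem_enum.
Qed.

Lemma free_seqs_uniq V m : uniq (free_seqs V m).
Proof.
elim: m => //= m IHm.
elim: (free_seqs V m) IHm => //= t ts IHts /andP[tts /IHts uts].
rewrite cat_uniq uts andbT map_inj_uniq ?filter_uniq -?enumT ?enum_uniq //=; last by move=> x y [].
apply/hasPn => s /flattenP[_ /mapP[t' t'ts ->] /mapP[x _ ->]].
by apply/mapP => -[y _ [_ tt]]; rewrite -tt t'ts in tts.
Qed.

Lemma size_free_seqs V m :
  size (free_seqs V m) = (\prod_(i < m) (q ^ \dim V - q ^ i))%N.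
Proof.
elim: m => [|m IHm] /=; first by rewrite big_ord0.
rewrite size_flatten /shape -map_comp big_ord_recr /= -IHm sumnE big_map.
rewrite -sum1_size big_distrl /=; apply: eq_big_seq => t.
rewrite mem_free_seqs => /and3P[/eqP st ft tV]; rewrite mul1n size_map size_filter.
have -> : (q ^ m = #|<<t>>%VS|)%N by rewrite card_vspace (eqP ft) st.
have -> : (q ^ \dim V = #|V|)%N by rewrite card_vspace.
rewrite -(cardID [in <<t>>%VS] [in V]) addnC.
have -> : #|[predI V & <<t>>%VS]| = #|<<t>>%VS|.
  by apply: eq_card => x; rewrite !inE andb_idl // => /(subvP tV).
rewrite addnK cardE -size_filter /enum_mem -filter_predI; congr size.
set e1 := Finite.enum _.
by apply: eq_filter => x; rewrite !inE andbT andbC.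
Qed.

Definition nsub V m := count (fun U => (U <= V)%VS && (\dim U == m)) subspaces.

Lemma size_free_seqs_span V m :
  size (free_seqs V m) = (nsub V m * \prod_(i < m) (q ^ m - q ^ i))%N.
Proof.
have -> : size (free_seqs V m) =
    (\sum_(U <- subspaces) count (fun t => <<t>>%VS == U) (free_seqs V m))%N.
  elim: (free_seqs V m) => [|t ts IHts] /=; first by rewrite big1_eq.
  rewrite big_split /= -IHts (bigD1_seq <<t>>%VS) ?mem_subspaces ?subspaces_uniq //=.
  by rewrite eqxx big1 // => U; rewrite eq_sym => /negbTE->.
rewrite /nsub -sum1_count big_distrl /= [RHS]big_mkcond /=; apply: eq_bigr => U _.
rewrite mul1n -size_filter; case: ifPn => [/andP[UV /eqP dU]|].
  rewrite -dU -size_free_seqs; apply/perm_size/uniq_perm; rewrite ?filter_uniq ?free_seqs_uniq //.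
  move=> t; rewrite mem_filter !mem_free_seqs; apply/idP/idP.
    by case/andP=> /eqP-> /and3P[-> -> _]; rewrite subvv.
  case/and3P=> st ft tU; rewrite st ft (subv_trans tU UV) !andbT.
  by rewrite eqEdim tU /= (eqP ft) (eqP st).
move=> NU; apply/eqP; rewrite size_filter eqn0Ngt -has_count.
apply: contra NU => /hasP[t + /eqP<-].
by rewrite mem_free_seqs => /and3P[/eqP<- /eqP-> ->]; rewrite eqxx.
Qed.

Lemma q_gt1 : (1 < q)%N.
Proof. exact: finNzRing_gt1. Qed.

(** Equate the two counts of independent tuples and cancel the powers of q; reversing the order of
    the denominators gives the product in [qbinom]. *)
Lemma nsub_qbinom V m : (nsub V m)%:R = qbinom q (\dim V) m.
Proof.
set d := \dim V; have [md|dm] := leqP m d; last first.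
  have -> : nsub V m = 0%N.
    apply/eqP; rewrite eqn0Ngt -has_count; apply/hasP => -[U _ /andP[/dimvS UV /eqP dU]].
    by rewrite dU leqNgt dm in UV.
  by rewrite /qbinom (bigD1 (Ordinal dm)) //= subnn expr0 subrr !mul0r.
have H := size_free_seqs V m; rewrite size_free_seqs_span -/d in H.
have {H} : (nsub V m)%:R * \prod_(i < m) (q%:R ^+ i * (q%:R ^+ (m - i) - 1)) =
    \prod_(i < m) (q%:R ^+ i * (q%:R ^+ (d - i) - 1)) :> rat.
  have E k : (m <= k)%N -> (\prod_(i < m) (q ^ k - q ^ i))%N%:R =
      \prod_(i < m) (q%:R ^+ i * (q%:R ^+ (k - i) - 1)) :> rat.
    move=> mk; rewrite natr_prod; apply: eq_bigr => i _.
    have ik : (i <= k)%N by rewrite (leq_trans _ mk) // ltnW.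
    rewrite natrB ?leq_pexp2l ?(ltnW q_gt1) // !natrX mulrBr mulr1 -exprD.
    by rewrite subnKC.
  by rewrite -!E // -natrM H.
rewrite !big_split /= mulrCA.
have q0 : \prod_(i < m) q%:R ^+ i != 0 :> rat.
  apply/prodf_neq0 => i _; rewrite expf_neq0 // pnatr_eq0.
  by rewrite -lt0n (ltnW q_gt1).
move/(mulfI q0); rewrite /qbinom prodf_div.
have -> : \prod_(i < m) (q%:R ^+ (m - i) - 1) = \prod_(i < m) (q%:R ^+ i.+1 - 1) :> rat.
  rewrite (reindex_inj rev_ord_inj) /=; apply: eq_bigr => i _.
  by rewrite subKn.
move=> <-; rewrite mulfK //.
by apply/prodf_neq0 => i _; apply/qint_neq0/q_gt1.
Qed.

End SubspaceCount.

(** * Counting normal words *)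

Section TruncatedEquality.
Variables (R : comNzRingType) (N : nat).
Implicit Types p q : {poly R}.

(** Congruence modulo t^(N+1); identities of power series are proved in this form for every [N]. *)
Definition eqm p q := forall i, (i <= N)%N -> p`_i = q`_i.

Lemma eqm_refl p : eqm p p.
Proof. by []. Qed.

Lemma eqm_sym p q : eqm p q -> eqm q p.
Proof. by move=> pq i iN; rewrite pq. Qed.

Lemma eqm_trans q p r : eqm p q -> eqm q r -> eqm p r.
Proof. by move=> pq qr i iN; rewrite pq ?qr. Qed.

Lemma eqmD p q p' q' : eqm p p' -> eqm q q' -> eqm (p + q) (p' + q').
Proof. by move=> pp qq i iN; rewrite !coefD pp ?qq. Qed.

Lemma eqmB p q p' q' : eqm p p' -> eqm q q' -> eqm (p - q) (p' - q').
Proof. by move=> pp qq i iN; rewrite !coefB pp ?qq. Qed.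

Lemma eqmM p q p' q' : eqm p p' -> eqm q q' -> eqm (p * q) (p' * q').
Proof.
move=> pp qq i iN; rewrite !coefM; apply: eq_bigr => j _.
by rewrite pp ?qq //; have := ltn_ord j; lia.
Qed.

Lemma eqm_sum (I : eqType) (r : seq I) (P : pred I) (f g : I -> {poly R}) :
  (forall i, P i -> eqm (f i) (g i)) ->
  eqm (\sum_(i <- r | P i) f i) (\sum_(i <- r | P i) g i).
Proof.
by move=> fg; apply: (big_ind2 eqm) => // p p' q q'; apply: eqmD.
Qed.
End TruncatedEquality.

Section NormalWordCount.
Variables (A : choiceType) (deg : A -> nat) (cov : rel A) (al : seq A).
Hypothesis al_full : forall a, a \in al.
Hypothesis deg_gt0 : forall a, (0 < deg a)%N.

Definition starts (P : pred A) (w : seq A) := if w is b :: _ then P b else false.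

Lemma normal_cons a w : normal cov (a :: w) = ~~ starts (cov a) w && normal cov w.
Proof. by case: w. Qed.

(** [m] is fuel: letters have positive degree, so any [m >= d] gives all normal words of degree
    [d]. *)
Fixpoint nwords m d : seq (seq A) :=
  if m is m'.+1 then
    if d == 0%N then [:: [::]] else
    flatten [seq [seq a :: w | w <- nwords m' (d - deg a)%N & ~~ starts (cov a) w]
                 | a <- al & (deg a <= d)%N]
  else if d == 0%N then [:: [::]] else [::].

Lemma mem_nwords m d w : (d <= m)%N ->
  (w \in nwords m d) = normal cov w && (sdeg deg w == d).
Proof.
elim: m d w => [|m IHm] d w dm.
  move: dm; rewrite leqn0 => /eqP-> /=; case: w => [|a w]; first by rewrite /sdeg big_nil.
  by rewrite inE /sdeg big_cons addn_eq0 gtn_eqF ?deg_gt0 // andbF.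
rewrite /=; have [->|d0] := eqVneq d 0%N.
  case: w => [|a w]; first by rewrite /sdeg big_nil.
  by rewrite inE /sdeg big_cons addn_eq0 [deg a == _]gtn_eqF ?deg_gt0 // andbF.
case: w => [|a w].
  rewrite /sdeg big_nil eq_sym (negbTE d0) andbF.
  by apply/negbTE/negP => /flattenP[_ /mapP[a _ ->] /mapP[]].
rewrite normal_cons /sdeg big_cons; apply/flattenP/idP => [[_ /mapP[b + ->] /mapP[u + [-> ->]]]|].
  rewrite !mem_filter => /andP[bd _] /andP[->]; rewrite IHm; last by have := deg_gt0 b; lia.
  by case/andP=> -> /eqP; rewrite /sdeg => -> /=; apply/eqP; lia.
case/andP=> /andP[aw nw] /eqP dE.
exists [seq a :: w | w <- nwords m (d - deg a)%N & ~~ starts (cov a) w].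
  by apply/mapP; exists a => //; rewrite mem_filter al_full andbT; lia.
apply/mapP; exists w => //; rewrite mem_filter aw IHm ?nw /=.
  by apply/eqP; rewrite /sdeg; lia.
by have := deg_gt0 a; lia.
Qed.

Hypothesis al_uniq : uniq al.

Lemma nwords_uniq m d : uniq (nwords m d).
Proof.
elim: m d => [|m IHm] d /=; first by case: eqP.
case: eqP => // _; elim: al al_uniq => //= a s IHs /andP[sa /IHs us].
case: ifP => //= ad; rewrite cat_uniq us andbT map_inj_uniq ?filter_uniq //; last by move=> x y [].
apply/hasPn => w /flattenP[_ /mapP[b + ->] /mapP[u _ ->]].
rewrite mem_filter => /andP[_ sb]; apply/mapP => -[v _ [ba _]].
by rewrite -ba sb in sa.
Qed.

Definition nword_list d := nwords d d.

Lemma nwords_perm m d : (d <= m)%N -> perm_eq (nwords m d) (nword_list d).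
Proof.
move=> dm; apply: uniq_perm; rewrite ?nwords_uniq // => w.
by rewrite !mem_nwords.
Qed.

Definition nword_count d := size (nword_list d).
Definition start_count (P : pred A) d := count (starts P) (nword_list d).

Lemma start_count0 P : start_count P 0 = 0%N.
Proof. by []. Qed.

Lemma nword_countE d : (0 < d)%N -> nword_count d = start_count predT d.
Proof.
move=> d0; apply/esym/eqP; rewrite -all_count; apply/allP => w.
by rewrite mem_nwords //; case: w => // /andP[_ /eqP dE]; rewrite -dE /sdeg big_nil in d0.
Qed.

(** Removing the first letter [a] leaves a normal word that does not start with a letter covered by
    [a]. *)
Lemma start_count_letter a d : start_count (pred1 a) d =
  if (deg a <= d)%N then (nword_count (d - deg a) - start_count (cov a) (d - deg a))%N else 0%N.
Proof.
case: d => [|d]; first by rewrite start_count0 leqNgt deg_gt0.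
have dE : nword_list d.+1 =
    flatten [seq [seq b :: w | w <- nwords d (d.+1 - deg b)%N & ~~ starts (cov b) w]
                 | b <- al & (deg b <= d.+1)%N] by [].
rewrite /start_count dE count_flatten -map_comp sumnE big_map big_filter.
have E b : count (starts (pred1 a))
    [seq b :: w | w <- nwords d (d.+1 - deg b)%N & ~~ starts (cov b) w] =
    if b == a then count (predC (starts (cov a))) (nword_list (d.+1 - deg a)) else 0%N.
  rewrite count_map; case: eqP => [->|/eqP ba]; last first.
    by apply/eqP; rewrite -leqn0 leqNgt -has_count; apply/hasPn => w _ /=.
  rewrite (eq_count (a2 := predT)) => [|w]; last by rewrite /= eqxx.
  rewrite count_predT size_filter; apply/permP/nwords_perm.
  by have := deg_gt0 a; lia.
under eq_bigr => b _ do rewrite /= E.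
rewrite big_mkcond (bigD1_seq a) //= eqxx big1 ?addn0 => [|b /negbTE->]; last by case: ifP.
case: ifP => // ad; rewrite /nword_count -(count_predC (starts (cov a))).
by rewrite addKn.
Qed.

Lemma start_count_split (Z : eqType) (f : A -> Z) (zs : seq Z) (P : pred A) d :
  uniq zs -> (forall a, P a = (f a \in zs)) ->
  start_count P d = (\sum_(z <- zs) start_count (fun a => f a == z) d)%N.
Proof.
move=> uzs Pz; rewrite /start_count; elim: (nword_list d) => [|w ws IHws] /=.
  by rewrite big1_eq.
rewrite big_split /= -IHws; congr addn; case: w => [|a w] /=; first by rewrite big1_eq.
rewrite Pz; case: (boolP (f a \in zs)) => az.
  by rewrite (bigD1_seq (f a)) //= eqxx big1 // => z; rewrite eq_sym => /negbTE->.
by rewrite big1_seq // => z /= zz; case: eqP => // faz; rewrite faz zz in az.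
Qed.

Variable N : nat.
Definition count_poly : {poly rat} := \poly_(i < N.+1) (nword_count i)%:R.
Definition start_poly P : {poly rat} := \poly_(i < N.+1) (start_count P i)%:R.

Lemma coef_count_poly i : (i <= N)%N -> count_poly`_i = (nword_count i)%:R.
Proof. by move=> iN; rewrite coef_poly ltnS iN. Qed.

Lemma coef_start_poly P i : (i <= N)%N -> (start_poly P)`_i = (start_count P i)%:R.
Proof. by move=> iN; rewrite coef_poly ltnS iN. Qed.

Lemma start_poly_letter a :
  eqm N (start_poly (pred1 a)) ('X^(deg a) * (count_poly - start_poly (cov a))).
Proof.
move=> i iN; rewrite coef_start_poly // start_count_letter coefXnM ltnNge.
case: ifP => //= ai; have iaN : (i - deg a <= N)%N by rewrite (leq_trans (leq_subr _ _)).
by rewrite coefB coef_count_poly // coef_start_poly // natrB // count_size.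
Qed.

Lemma start_poly_split (Z : eqType) (f : A -> Z) (zs : seq Z) (P : pred A) :
  uniq zs -> (forall a, P a = (f a \in zs)) ->
  start_poly P = \sum_(z <- zs) start_poly (fun a => f a == z).
Proof.
move=> uzs Pz; apply/polyP => i; rewrite coef_sum coef_poly; case: ifP => iN; last first.
  by rewrite big1 // => z _; rewrite coef_poly iN.
rewrite (start_count_split i uzs Pz) natr_sum; apply: eq_bigr => z _.
by rewrite coef_start_poly.
Qed.

Lemma count_polyE : eqm N count_poly (1 + start_poly predT).
Proof.
move=> i iN; rewrite coefD coefC coef_count_poly // coef_start_poly //.
by case: i iN => [|i] iN; rewrite ?start_count0 ?addr0 //= add0r nword_countE.
Qed.

Lemma eq_start_poly (P Q : pred A) : P =1 Q -> start_poly P = start_poly Q.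
Proof.
move=> PQ; apply/polyP => i; rewrite !coef_poly; case: ifP => // _; congr _%:R.
by apply: eq_count => -[|a w] //=.
Qed.
End NormalWordCount.

(** * Generating functions of the normal words of subspaces *)

Section SubspaceWords.
Variables (K : finFieldType) (n : nat).
Local Notation vT := 'rV[K]_n.
Local Notation q := #|K|.
Local Notation dimv := (fun U : {vspace vT} => \dim U).
Local Notation letter := (letter dimv).
Implicit Types (U V W : {vspace vT}).

Definition above V U := (U <= V)%VS && (U != V).

Lemma above_dim V U : above V U -> (\dim U < \dim V)%N.
Proof.
case/andP=> UV NUV; rewrite ltn_neqAle dimvS // andbT.
by apply: contra NUV => /eqP dUV; rewrite eqEdim UV dUV leqnn.
Qed.

Definition letters : seq letter :=
  pmap insub [seq (U, k) | U <- subspaces K n, k <- iota 1 (\dim U)].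

Lemma letters_uniq : uniq letters.
Proof.
apply: pmap_sub_uniq; apply: allpairs_uniq_dep.
- exact: subspaces_uniq.
- by move=> U _; apply: iota_uniq.
by move=> [U k] [V l] _ _ /= [-> ->].
Qed.

Lemma mem_letters (a : letter) : a \in letters.
Proof.
rewrite mem_pmap_sub; apply/allpairsPdep; exists (val a).1, (val a).2.
rewrite mem_subspaces mem_iota -surjective_pairing; split=> //.
by have := valP a; rewrite add1n ltnS.
Qed.

Local Notation ldeg := (@ldeg _ dimv).
Local Notation cov := (@cov _ dimv above).

Lemma ldeg_gt0 (a : letter) : (0 < ldeg a)%N.
Proof. by have /andP[] := valP a. Qed.

Definition subspace_words := nword_list ldeg cov letters.

Lemma subspace_words_uniq d : uniq (subspace_words d).
Proof. exact: nwords_uniq letters_uniq _ _. Qed.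

Lemma mem_subspace_words d w :
  (w \in subspace_words d) = normal cov w && (sdeg ldeg w == d).
Proof. exact: (mem_nwords cov mem_letters ldeg_gt0 w (leqnn d)). Qed.

Variable N : nat.
Local Notation H := (count_poly ldeg cov letters N).
Local Notation C := (start_poly ldeg cov letters N).
Local Notation "p =m q" := (eqm N p q) (at level 70).

Definition vpoly V := C (fun a => (val a).1 == V).

(** Split the words by their first letter (V,k). The rest must not start with a letter of any U
    below V with k = dim V - dim U, and each U occurs for exactly one k. *)
Lemma vpolyE V : vpoly V =m
  (\sum_(k <- iota 1 (\dim V)) 'X^k) * H -
  \sum_(U <- subspaces K n | above V U) 'X^(\dim V - \dim U) * vpoly U.
Proof.
pose zs := [seq (V, k) | k <- iota 1 (\dim V)].
have uzs : uniq zs by rewrite map_inj_uniq ?iota_uniq // => k l [].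
have Pzs (a : letter) : ((val a).1 == V) = (val a \in zs).
  apply/eqP/mapP => [aV|[k _ ->] //]; exists (val a).2; last by rewrite -aV -surjective_pairing.
  by have := valP a; rewrite mem_iota add1n ltnS aV.
rewrite /vpoly (start_poly_split ldeg cov letters N uzs Pzs) big_map.
have -> : (\sum_(k <- iota 1 (\dim V)) 'X^k) * H -
  \sum_(U <- subspaces K n | above V U) 'X^(\dim V - \dim U) * vpoly U =
  \sum_(k <- iota 1 (\dim V)) 'X^k * (H -
     \sum_(U <- subspaces K n | above V U && (k == \dim V - \dim U)%N) vpoly U).
  rewrite [RHS](eq_bigr _ (fun k _ => mulrBr _ _ _)) sumrB -mulr_suml; congr (_ - _).
  under [RHS]eq_bigr do rewrite big_mkcondr mulr_sumr.
  rewrite [RHS]exchange_big /=; apply: eq_bigr => U VU.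
  rewrite (bigD1_seq (\dim V - \dim U)%N) ?iota_uniq //= ?eqxx.
    rewrite big1 ?addr0 // => k /negbTE->; first by rewrite mulr0.
  by rewrite mem_iota; have := above_dim VU; lia.
rewrite big_seq [X in _ =m X]big_seq; apply: eqm_sum => k.
rewrite mem_iota add1n ltnS => kV.
pose a : letter := exist _ (V, k) kV.
rewrite (@eq_start_poly _ _ _ _ _ _ (pred1 a)); last by move=> b; rewrite /= -val_eqE.
apply: eqm_trans (start_poly_letter cov mem_letters ldeg_gt0 letters_uniq a) _.
apply: eqmM => //; apply: eqmB => //.
pose us := [seq U <- subspaces K n | above V U && (k == \dim V - \dim U)%N].
have uus : uniq us by rewrite filter_uniq ?subspaces_uniq.
rewrite (start_poly_split (f := fun b : letter => (val b).1) ldeg cov letters N uus).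
  by rewrite big_filter.
by move=> b; rewrite mem_filter mem_subspaces andbT.
Qed.

Lemma sum_by_dim V (f : nat -> {poly rat}) :
  \sum_(U <- subspaces K n | (U <= V)%VS) f (\dim U) =
  \sum_(j < (\dim V).+1) (qbinom q (\dim V) j)%:P * f j.
Proof.
have dlt U : (U <= V)%VS -> (\dim U < (\dim V).+1)%N by move/dimvS.
transitivity (\sum_(U <- subspaces K n | (U <= V)%VS) \sum_(j < (\dim V).+1)
    (if \dim U == j then f j else 0)).
  apply: eq_bigr => U UV; rewrite (bigD1 (Ordinal (dlt U UV))) //= eqxx big1 ?addr0 // => j jU.
  by case: eqP => // dU; case/eqP: jU; apply: val_inj.
rewrite exchange_big /=; apply: eq_bigr => j _; rewrite -big_mkcondr /=.
rewrite -nsub_qbinom /nsub -sum1_count natr_sum rmorph_sum mulr_suml.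
by apply: eq_bigr => U _; rewrite mul1r.
Qed.

Lemma sum_above V (f : {vspace vT} -> {poly rat}) :
  \sum_(U <- subspaces K n | (U <= V)%VS) f U =
  f V + \sum_(U <- subspaces K n | above V U) f U.
Proof.
rewrite big_mkcond (bigD1_seq V) ?mem_subspaces ?subspaces_uniq //= subvv.
by congr (_ + _); rewrite -big_mkcondr; apply: eq_bigl => U; rewrite andbC.
Qed.

(** The value of (1-t) G_V / (t H) for dim V = j; the correction at j = 0 reflects that the zero
    subspace has no letters. *)
Definition qpoch0 j := qpoch q j - (j == 0%N)%:R.

(** This is [qbinom_qpoch] grouped by dimension; the correction at the zero subspace gives t^(dim
    V). *)
Lemma qpoch0_sum V :
  \sum_(U <- subspaces K n | (U <= V)%VS) 'X^(\dim V - \dim U) * qpoch0 (\dim U) =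
  1 - 'X^(\dim V).
Proof.
rewrite (sum_by_dim V (fun j => 'X^(\dim V - j) * qpoch0 j)).
under eq_bigr do rewrite /qpoch0 !mulrBr.
rewrite sumrB qbinom_qpoch ?q_gt1 // big_ord_recl qbinom0 subn0 mulr1 mul1r.
by rewrite big1 ?addr0 // => j _; rewrite !mulr0.
Qed.

Lemma geometric_sum d : (1 - 'X) * \sum_(k <- iota 1 d) 'X^k = 'X * (1 - 'X^d) :> {poly rat}.
Proof.
elim: d => [|d IHd]; first by rewrite big_nil mulr0 expr0 subrr mulr0.
rewrite -[in iota _ _](addn1 d) iotaD big_cat big_seq1 mulrDr IHd add1n !exprS; ring.
Qed.

(** Induction on the dimension: with the closed forms inserted for all U below V in [vpolyE],
    [qpoch0_sum] leaves only the term of V. *)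
Lemma vpoly_closed V : (1 - 'X) * vpoly V =m 'X * qpoch0 (\dim V) * H.
Proof.
have [m] := ubnP (\dim V); elim: m V => // m IHm V ltVm.
have H1 : (1 - 'X) * vpoly V =m ('X * (1 - 'X^(\dim V))) * H -
    \sum_(U <- subspaces K n | above V U) 'X^(\dim V - \dim U) * ('X * qpoch0 (\dim U) * H).
  apply: eqm_trans (eqmM (eqm_refl _) (vpolyE V)) _.
  rewrite mulrBr mulrA geometric_sum mulr_sumr; apply: eqmB => //.
  apply: eqm_sum => U VU; rewrite mulrCA; apply: eqmM => //; apply: IHm.
  by have := above_dim VU; lia.
apply: eqm_trans H1 _; rewrite -qpoch0_sum sum_above.
rewrite subnn expr0 mul1r mulrDr mulrDl -addrA mulr_sumr mulr_suml.
rewrite [X in _ + (X - _)](eq_bigr (fun U =>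
  'X^(\dim V - \dim U) * ('X * qpoch0 (\dim U) * H))) => [|U _]; last by ring.
by rewrite subrr addr0.
Qed.

(** Inserting [vpoly_closed] in H = 1 + sum_V G_V, multiplied by 1 - t, gives a linear equation for
    H. *)
Lemma count_poly_closed :
  H * (1 - 'X * \sum_(j < n.+1) (qbinom q n j)%:P * qpoch q j) =m 1 - 'X.
Proof.
set S := \sum_(j < _) _.
have Ssum : \sum_(U <- subspaces K n) qpoch0 (\dim U) = S - 1.
  have := sum_by_dim fullv qpoch0; rewrite (eq_bigl predT) => [->|U]; last exact: subvf.
  rewrite dimvf /dim /= mul1n /qpoch0; under eq_bigr do rewrite mulrBr.
  rewrite sumrB; congr (_ - _); rewrite big_ord_recl qbinom0 mul1r.
  by rewrite big1 ?addr0 // => j _; rewrite mulr0.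
have HE : H =m 1 + \sum_(U <- subspaces K n) vpoly U.
  apply: eqm_trans (count_polyE cov mem_letters ldeg_gt0 (N := N)) _; apply: eqmD => //.
  rewrite (start_poly_split (f := fun b : letter => (val b).1) ldeg cov letters N
    (subspaces_uniq K n)) // => b.
  by rewrite mem_subspaces.
have : (1 - 'X) * H =m (1 - 'X) + 'X * (S - 1) * H.
  apply: eqm_trans (eqmM (eqm_refl _) HE) _; rewrite mulrDr mulr1; apply: eqmD => //.
  rewrite -Ssum mulr_sumr [in X in _ =m X]mulr_sumr mulr_suml.
  by apply: eqm_sum => U _; apply: vpoly_closed.
move/eqmB => /(_ _ _ (eqm_refl ('X * (S - 1) * H))); rewrite addrK.
by congr (_ =m _); ring.
Qed.

End SubspaceWords.

(** * From truncated identities to division of power series *)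

Lemma fps_mul_trunc (f g : nat -> rat) N i : (i <= N)%N ->
  fps_mul f g i = (\poly_(k < N.+1) f k * \poly_(k < N.+1) g k)`_i.
Proof.
move=> iN; rewrite /fps_mul coefM; apply: eq_bigr => j _.
by rewrite !coef_poly !ifT //; have := ltn_ord j; lia.
Qed.

(** Multiplying the truncated identity by the truncated inverse of [h] isolates [b]. *)
Lemma fps_div_eq (p b : {poly rat}) (h : nat -> rat) : h 0%N != 0 ->
    (forall N, eqm N (\poly_(k < N.+1) h k * b) p) ->
  forall i, fps_div (fps_of_poly p) h i = fps_of_poly b i.
Proof.
move=> h0 hb i; rewrite /fps_div (fps_mul_trunc _ _ (leqnn i)).
set v := \poly_(k < i.+1) fps_inv h k; set u := \poly_(k < i.+1) h k in hb *.
have pE : eqm i (\poly_(k < i.+1) fps_of_poly p k) p.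
  by move=> j ji; rewrite coef_poly ltnS ji.
have uv : eqm i (\poly_(k < i.+1) h k * v) 1.
  by move=> j ji; rewrite -fps_mul_trunc // fps_mulV // coefC; case: (j == 0%N).
have: eqm i (p * v) b.
  apply: eqm_trans (eqmM (eqm_sym (hb i)) (eqm_refl _)) _.
  rewrite mulrAC; apply: eqm_trans (eqmM uv (eqm_refl _)) _.
  by rewrite mul1r.
move/(eqm_trans (eqmM pE (eqm_refl v)))/(_ i (leqnn i)) => -> //.
Qed.

(** * The lattice of subspaces as a ranked poset *)

Section SubspaceGraph.
Variables (K : finFieldType) (n : nat).
Local Notation G := (subspace_graph K n).
Local Notation above := (@above K n).

Lemma above_trans : transitive above.
Proof.
move=> V U W UV VW; have := ltn_trans (above_dim VW) (above_dim UV).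
case/andP: UV VW => UV _ /andP[VW _] dWU; rewrite /above (subv_trans VW UV).
by apply: contraTneq dWU => ->; rewrite ltnn.
Qed.

Lemma above_edge (e : edge G) : above (tail e) (head e).
Proof.
case: e => -[V U] c; have := c; rewrite /covers /above /= => /andP[-> /eqP dV].
by apply: contra_eqN dV => /eqP->; rewrite neq_ltn ltnSn.
Qed.

(** A vector of [V] outside [U] enlarges [U] by one dimension; the edge from the larger subspace to
    [U] ends a chain given by induction. *)
Lemma above_chain (V U : vertex G) : above V U -> exists p, chain V p U.
Proof.
have [m] := ubnP (\dim (V : {vspace _}) - \dim (U : {vspace _}))%N.
elim: m U => // m IHm U ltm VU; have ltd := above_dim VU; have /andP[UV _] := VU.
have [x xV xU] : exists2 x, x \in (V : {vspace 'rV[K]_n}) & x \notin (U : {vspace 'rV[K]_n}).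
  apply/subvPn; apply: contraL ltd => /dimvS; by rewrite leqNgt.
pose W := (U + <[x]>)%VS.
have dW : \dim W = (\dim (U : {vspace _})).+1.
  rewrite /W dimv_disjoint_sum ?dim_vline; last first.
    apply/eqP; rewrite -subv0; apply/subvP => y; rewrite memv_cap => /andP[yU /vlineP[c yE]].
    have [c0|c0] := eqVneq c 0; first by rewrite yE c0 scale0r mem0v.
    by rewrite yE rpredZeq (negbTE c0) (negbTE xU) in yU.
  have -> : x != 0 by apply: contraNneq xU => ->; apply: mem0v.
  by rewrite addn1.
have WV : (W <= V)%VS by rewrite subv_add UV -memvE.
have cWU : covers (W, U) by rewrite /covers /= addvSl dW eqxx.
pose e : edge G := exist _ (W, U) cWU.
have [VW|VW] := eqVneq V W; first by exists [:: e]; rewrite /= VW !eqxx.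
have [p cp] : exists p, @chain G V p W.
  apply: IHm; last by rewrite /above WV eq_sym.
  by rewrite dW; lia.
by exists (rcons p e); rewrite -cats1; apply: chain_cat cp _; rewrite /= !eqxx.
Qed.

Lemma above_bot (V : vertex G) : V = 0%VS :> {vspace _} \/ above V 0%VS.
Proof.
have [->|V0] := eqVneq (V : {vspace _}) 0%VS; [by left|right].
by rewrite /above sub0v eq_sym.
Qed.

End SubspaceGraph.

Theorem theorem4 (F : fieldType) (K : finFieldType) (q n : nat)
    (q_primepower : exists p k : nat, [/\ prime p, (0 < k)%N & q = (p ^ k)%N])
    (card_K : #|K| = q) :
  exists h : nat -> nat,
    hilbert_function F (subspace_graph K n) h /\
    forall i : nat,
      fps_div (fps_of_poly (1 - 'X)) (fun j => (h j)%:R) i =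
      fps_of_poly
        (1 - 'X * \sum_(m < n.+1)
           (qbinom q n m)%:P * \prod_(j < n - m) (1 - (q ^ j)%:R%:P * 'X)) i.
Proof.
exists (fun d => size (subspace_words K n d)); split.
  move=> d.
  apply: (@graph_alg_has_dim F (subspace_graph K n) (@above K n) 0%VS (malg_free F _)).
  - exact: above_trans.
  - exact: above_dim.
  - exact: above_edge.
  - exact: above_chain.
  - exact: above_bot.
  - exact: dimv0.
  - exact: subspace_words_uniq.
  - exact: mem_subspace_words.
apply: fps_div_eq => // N; have := count_poly_closed K n (N := N); rewrite card_K.
congr (eqm N (_ * (1 - 'X * _)) _).
(* Replace [m] by [n - m] and use the symmetry of Gaussian binomials. *)
rewrite (reindex_inj rev_ord_inj) /=; apply: eq_bigr => m _.
have mn : (m <= n)%N by rewrite -ltnS.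
by rewrite subSS qbinom_sym // -card_K q_gt1.
Qed.
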